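(* If the matroid $Q^{NF}_3(\mathsf{Q}_8)$ is algebraically representable over a field $\mathbb{K}$, then $\operatorname{char}(\mathbb{K})=2$.
   Context: **Algebraic representations.** Let $M=(E,r)$ be a matroid on a finite ground set $E$ with rank function $r$, and let $\mathbb{K}$ be a field. An algebraic representation of $M$ over $\mathbb{K}$ is a map $\pi\colon E\to\mathbb{F}$, for some field extension $\mathbb{K}\subseteq\mathbb{F}$, such that for every $X\subseteq E$ the rank $r(X)$ equals the transcendence degree of $\mathbb{K}(\pi(X))$ over $\mathbb{K}$. If one exists, $M$ is algebraically representable over $\mathbb{K}$. **$k$-linear representations.** For $k\in\mathbb{N}$, $k\ge 1$, a $k$-linear representation of $M=(E,r)$ over a field $\mathbb{F}$ is a matrix over $\mathbb{F}$ whose columns are grouped into blocks of $k$ columns, one block for each $e\in E$, such that for every $X\subseteq E$, $r(X)=\frac1k\dim\operatorname{span}$ of all columns in the blocks of the elements of $X$. **The matroid $Q^{NF}_3(\mathsf{Q}_8)$.** Let $\mathsf{Q}_8=\{\pm\mathsf{e},\pm\mathsf{i},\pm\mathsf{j},\pm\mathsf{k}\}$ be the quaternion group with identity $\mathsf{e}$. Let $\mathbb{F}_{49}$ be the field with 49 elements and $\zeta_4\in\mathbb{F}_{49}$ a primitive fourth root of unity. Let $\rho\colon\mathsf{Q}_8\to GL_2(\mathbb{F}_{49})$ be the representation $$\rho(\pm\mathsf{e})=\pm\begin{pmatrix}1&0\\0&1\end{pmatrix},\ \rho(\pm\mathsf{i})=\pm\begin{pmatrix}\zeta_4&0\\0&-\zeta_4\end{pmatrix},\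 \rho(\pm\mathsf{j})=\pm\begin{pmatrix}0&-1\\1&0\end{pmatrix},\ \rho(\pm\mathsf{k})=\pm\begin{pmatrix}0&-\zeta_4\\-\zeta_4&0\end{pmatrix}.$$ $Q^{NF}_3(\mathsf{Q}_8)$ is the matroid on the 28-element ground set $E=\{p_1,p_2,p_3\}\cup\{g^{(i)}: g\in\mathsf{Q}_8,\ i=1,2,3\}\cup\{O\}$ whose 2-linear representation over $\mathbb{F}_{49}$ is the $6\times 56$ matrix $\mathbf{A}^*_\rho$ with the following $6\times2$ column blocks (each written as three stacked $2\times 2$ blocks, $I_2$ the identity): $p_1\mapsto(I_2,0,0)^T$, $p_2\mapsto(0,I_2,0)^T$, $p_3\mapsto(0,0,I_2)^T$, $g^{(1)}\mapsto(-I_2,\rho(g),0)^T$, $g^{(2)}\mapsto(0,-I_2,\rho(g))^T$, $g^{(3)}\mapsto(\rho(g),0,-I_2)^T$, $O\mapsto(I_2,I_2,I_2)^T$, where $(A,B,C)^T$ denotes stacking $A$, $B$, $C$ vertically without transposing the individual blocks. That is, $r(X)$ is half of the rank of the submatrix formed by the blocks of the elements of $X$ (these ranks are all even, so this defines a matroid). *)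

(* Defs.v *)
From HB Require Import structures.
From Stdlib Require Import ZArith.
From mathcomp Require Import all_boot all_order all_algebra all_fingroup all_field.
From mathcomp Require Import mpoly.
From mathcomp Require Import zify ssrZ ring.

Set Implicit Arguments.
Unset Strict Implicit.
Unset Printing Implicit Defensive.

Import GRing.Theory.
Local Open Scope ring_scope.

Record matroid (E : finType) := Matroid {
  rk :> {set E} -> nat;
  rk_card : forall X : {set E}, (rk X <= #|X|)%N;
  rk_mono : forall X Y : {set E}, X \subset Y -> (rk X <= rk Y)%N;
  rk_submod : forall X Y : {set E}, (rk (X :|: Y) + rk (X :&: Y) <= rk X + rk Y)%N
}.

(* A field extension K <= L is given as a ring morphism, subfields and
   generating sets as predicates on L. *)

Section Transcendence.
Variables (K L : fieldType) (iota : {rmorphism K -> L}).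

Record is_subfield (P : L -> Prop) : Prop := IsSubfield {
  subfield1 : P 1;
  subfieldB : forall x y, P x -> P y -> P (x - y);
  subfieldM : forall x y, P x -> P y -> P (x * y);
  subfieldV : forall x, P x -> P x^-1
}.

Definition adjoin (S : L -> Prop) (x : L) : Prop :=
  forall P : L -> Prop, is_subfield P ->
    (forall a : K, P (iota a)) -> (forall y, S y -> P y) -> P x.

Definition algebraic_over (P : L -> Prop) (x : L) : Prop :=
  exists p : {poly L}, [/\ p != 0, forall i, P p`_i & root p x].

Definition alg_independent n (b : 'I_n -> L) : Prop :=
  forall p : {mpoly K[n]}, mmap iota b p = 0 -> p = 0.

Definition transcendence_basis (P : L -> Prop) n (b : 'I_n -> L) : Prop :=
  [/\ alg_independent b,
      forall i, P (b i) &
      forall x, P x -> algebraic_over (adjoin (fun y => exists i, y = b i)) x].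

Definition trdeg_is (P : L -> Prop) (n : nat) : Prop :=
  exists b : 'I_n -> L, transcendence_basis P b.

Definition algebraic_representation (E : finType) (M : matroid E)
    (f : E -> L) : Prop :=
  forall X : {set E},
    trdeg_is (adjoin (fun y => exists2 e, e \in X & y = f e)) (M X).

End Transcendence.

Definition algebraically_representable (E : finType) (M : matroid E)
    (K : fieldType) : Prop :=
  exists (L : fieldType) (iota : {rmorphism K -> L}) (f : E -> L),
    algebraic_representation iota M f.

Section KLinear.
Variables (F : fieldType) (E : finType) (m k : nat) (A : E -> 'M[F]_(m, k)).

(* The rank of the submatrix formed by the column blocks of the elements
   of [X]. *)
Definition block_rank (X : {set E}) : nat :=
  \rank (\mxrow_(i < #|X|) A (enum_val i)).

Definition klinear_representation (M : matroid E) : Prop :=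
  (0 < k)%N /\ forall X : {set E}, (k * M X)%N = block_rank X.

Lemma block_rankE X :
  block_rank X = \rank (\sum_(e in X) <<(A e)^T>>)%MS.
Proof.
rewrite /block_rank -mxrank_tr tr_mxrow eqmx_col [in RHS]big_enum_val.
by [].
Qed.

Lemma block_rank_le X : (block_rank X <= #|X| * k)%N.
Proof.
apply: leq_trans (rank_leq_col _) _.
by rewrite big_const card_ord iter_addn_0 mulnC.
Qed.

Lemma block_rank_mono (X Y : {set E}) : X \subset Y -> (block_rank X <= block_rank Y)%N.
Proof.
move=> /subsetP sXY; rewrite !block_rankE; apply: mxrankS.
by apply/sumsmx_subP => e eX; apply: (sumsmx_sup e) => //; apply: sXY.
Qed.

Lemma block_rank_submod (X Y : {set E}) :
  (block_rank (X :|: Y) + block_rank (X :&: Y)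
     <= block_rank X + block_rank Y)%N.
Proof.
rewrite !block_rankE -[leqRHS]mxrank_sum_cap leq_add //; apply: mxrankS.
  apply/sumsmx_subP => e /setUP [eX|eY].
    by apply: submx_trans (addsmxSl _ _); apply: (sumsmx_sup e).
  by apply: submx_trans (addsmxSr _ _); apply: (sumsmx_sup e).
apply/sumsmx_subP => e /setIP [eX eY]; rewrite sub_capmx.
by apply/andP; split; apply: (sumsmx_sup e).
Qed.

Hypothesis dvd_rank : forall X, (k %| block_rank X)%N.

Definition klinear_matroid : matroid E.
Proof.
refine (@Matroid E (fun X => block_rank X %/ k)%N _ _ _).
- by move=> X; rewrite leq_divLR // block_rank_le.
- by move=> X Y sXY; apply/leq_div2r/block_rank_mono.
- by move=> X Y; rewrite -!divnDl // leq_div2r // block_rank_submod.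
Defined.

Lemma klinear_matroidP :
  (0 < k)%N -> klinear_representation klinear_matroid.
Proof. by split=> // X; rewrite /= mulnC divnK. Qed.

End KLinear.

(* The quaternion group: [(s, u)] stands for (-1)^s u. *)

Variant qunit := qe | qi | qj | qk.

Definition qunit_code (u : qunit) : 'I_4 :=
  inord (match u with qe => 0 | qi => 1 | qj => 2 | qk => 3 end)%N.
Definition qunit_decode (i : 'I_4) : qunit :=
  match val i with 0 => qe | 1 => qi | 2 => qj | _ => qk end.
Lemma qunit_codeK : cancel qunit_code qunit_decode.
Proof. by case; rewrite /qunit_decode /= inordK. Qed.
HB.instance Definition _ := Finite.copy qunit (can_type qunit_codeK).

Definition Q8 : Type := (bool * qunit)%type.
HB.instance Definition _ := Finite.on Q8.

Definition qunit_mul (u v : qunit) : Q8 :=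
  match u, v with
  | qe, w | w, qe => (false, w)
  | qi, qi | qj, qj | qk, qk => (true, qe)
  | qi, qj => (false, qk) | qj, qi => (true, qk)
  | qj, qk => (false, qi) | qk, qj => (true, qi)
  | qk, qi => (false, qj) | qi, qk => (true, qj)
  end.
Definition Q8_mul (g h : Q8) : Q8 :=
  let w := qunit_mul g.2 h.2 in (g.1 (+) h.1 (+) w.1, w.2).
Definition Q8_inv (g : Q8) : Q8 :=
  (match g.2 with qe => g.1 | _ => ~~ g.1 end, g.2).

Lemma Q8_mulA : associative Q8_mul.
Proof. by move=> [[] []] [[] []] [[] []]. Qed.
Lemma Q8_mul1 : left_id (false, qe) Q8_mul.
Proof. by move=> [[] []]. Qed.
Lemma Q8_mulV : left_inverse (false, qe) Q8_inv Q8_mul.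
Proof. by move=> [[] []]. Qed.
HB.instance Definition _ :=
  Finite_isGroup.Build Q8 Q8_mulA Q8_mul1 Q8_mulV.

Section Rho.
Variables (F : fieldType) (z : F).

Definition mx2 (a b c d : F) : 'M[F]_2 :=
  \matrix_(i < 2, j < 2) nth 0 (nth [::] [:: [:: a; b]; [:: c; d]] i) j.

Definition rho (g : Q8) : 'M[F]_2 :=
  (-1) ^+ g.1 *:
  match g.2 with
  | qe => mx2 1 0 0 1
  | qi => mx2 z 0 0 (- z)
  | qj => mx2 0 (-1) 1 0
  | qk => mx2 0 (- z) (- z) 0
  end.

End Rho.

Lemma rhoM (F : fieldType) (z : F) : z ^+ 2 = -1 ->
  {morph rho z : g h / (g * h)%g >-> g *m h}.
Proof.
rewrite expr2 => zz.
have mx2M a b c d a' b' c' d' : mx2 a b c d *m mx2 a' b' c' d' =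
    mx2 (a * a' + b * c') (a * b' + b * d') (c * a' + d * c') (c * b' + d * d')
    :> 'M[F]_2.
  apply/matrixP => -[[|[|i]] Hi] // [[|[|j]] Hj] //;
  by rewrite !mxE !big_ord_recl big_ord0 /= !mxE addr0.
move=> [s u] [t v]; rewrite /rho /= -scalemxAl -scalemxAr scalerA.
rewrite 2!signr_addb -[LHS]scalerA; congr (_ *: _).
by case: u; case: v; rewrite mx2M /= ?expr0 ?expr1 ?scale1r ?scaleN1r;
  apply/matrixP => -[[|[|i]] Hi] // [[|[|j]] Hj] //; rewrite !mxE /=; ring: zz.
Qed.

Variant ground := Pt of 'I_3 | El of Q8 & 'I_3 | OO.

Definition ground_code (e : ground) : 'I_3 + Q8 * 'I_3 + unit :=
  match e with
  | Pt i => inl (inl i) | El g i => inl (inr (g, i)) | OO => inr tt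
  end.
Definition ground_decode (s : 'I_3 + Q8 * 'I_3 + unit) : ground :=
  match s with
  | inl (inl i) => Pt i | inl (inr (g, i)) => El g i | inr _ => OO
  end.
Lemma ground_codeK : cancel ground_code ground_decode.
Proof. by case. Qed.
HB.instance Definition _ := Finite.copy ground (can_type ground_codeK).

Section Blocks.
Variables (F : fieldType) (z : F).

Definition stack (A B C : 'M[F]_2) : 'M[F]_(6, 2) :=
  col_mx A (col_mx B C : 'M_(4, 2)).

(* The index i = 1, 2, 3 of the text is the ordinal i - 1 here. *)
Definition Astar (e : ground) : 'M[F]_(6, 2) :=
  match e with
  | Pt i => match val i with
            | 0 => stack 1%:M 0 0
            | 1 => stack 0 1%:M 0
            | _ => stack 0 0 1%:M
            end
  | El g i => match val i with
              | 0 => stack (- 1%:M) (rho z g) 0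
              | 1 => stack 0 (- 1%:M) (rho z g)
              | _ => stack (rho z g) 0 (- 1%:M)
              end
  | OO => stack 1%:M 1%:M 1%:M
  end.

End Blocks.

(* The block ranks of [Astar] are even: for distinct e and f, the columns of
   any third block either lie in the span of those of e and f, or together
   with them span the whole space.  Which case occurs is decided by computing
   with integer quaternions modulo 7. *)

Module ZQuat.
Local Open Scope Z_scope.

Definition quat : Type := Z * Z * Z * Z.
Definition vec : Type := quat * quat * quat.

Definition zero : quat := (0, 0, 0, 0).
Definition one : quat := (1, 0, 0, 0).

Definition add (p q : quat) : quat :=
  let: (a, b, c, d) := p in let: (a', b', c', d') := q in
  (a + a', b + b', c + c', d + d').
Definition mul (p q : quat) : quat :=
  let: (a, b, c, d) := p in let: (a', b', c', d') := q in
  (a * a' - b * b' - c * c' - d * d', a * b' + b * a' + c * d' - d * c',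
   a * c' - b * d' + c * a' + d * b', a * d' + b * c' - c * b' + d * a').
Definition opp (p : quat) : quat :=
  let: (a, b, c, d) := p in (- a, - b, - c, - d).
Definition red (p : quat) : quat :=
  let: (a, b, c, d) := p in (a mod 7, b mod 7, c mod 7, d mod 7).
Definition inv (p : quat) : quat :=
  let: (a, b, c, d) := p in
  let m := ((a * a + b * b + c * c + d * d) ^ 5) mod 7 in
  red (m * a, - (m * b), - (m * c), - (m * d)).
Definition eqq (p q : quat) : bool :=
  let: (a, b, c, d) := red p in let: (a', b', c', d') := red q in
  [&& Z.eqb a a', Z.eqb b b', Z.eqb c c' & Z.eqb d d'].

Definition vmap2 (f : quat -> quat -> quat) (u v : vec) : vec :=
  let: (a, b, c) := u in let: (a', b', c') := v in (f a a', f b b', f c c').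
Definition vmap (f : quat -> quat) (u : vec) : vec :=
  let: (a, b, c) := u in (f a, f b, f c).
Definition vadd := vmap2 add.
Definition vmulr (u : vec) (q : quat) : vec := vmap (fun a => mul a q) u.
Definition vred := vmap red.
Definition veq (u v : vec) : bool :=
  let: (a, b, c) := u in let: (a', b', c') := v in
  [&& eqq a a', eqq b b' & eqq c c'].
Definition vnth (u : vec) (i : nat) : quat :=
  let: (a, b, c) := u in match i with O => a | S O => b | _ => c end.
Definition base (i : nat) : vec :=
  match i with
  | O => (one, zero, zero) | S O => (zero, one, zero) | _ => (zero, zero, one)
  end.

Definition comb (u v w x : vec) : vec :=
  let: (a, b, c) := x in vadd (vmulr u a) (vadd (vmulr v b) (vmulr w c)).

(* Gauss-Jordan elimination on u, v and a base vector that completes them; it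
   only proposes certificates, which [good] checks. *)
Definition pivot (u : vec) : nat :=
  find (fun i => eqq (mul (vnth u i) (inv (vnth u i))) one) [:: 0; 1]%N.

Definition aug : Type := vec * vec.
Definition aug_mulr (x : aug) q : aug :=
  (vred (vmulr x.1 q), vred (vmulr x.2 q)).
Definition elim (i : nat) (x y : aug) : aug :=
  let z := aug_mulr x (opp (vnth y.1 i)) in
  (vred (vadd y.1 z.1), vred (vadd y.2 z.2)).
Definition normalise (i : nat) (x : aug) : aug :=
  aug_mulr x (inv (vnth x.1 i)).

Definition certificate (u v : vec) : nat * seq vec :=
  let i := pivot u in
  let x := normalise i (u, base 0) in
  let y := elim i x (v, base 1) in
  let j := pivot y.1 in
  let y := normalise j y in
  let x := elim j y x in
  let k := (3 - (i + j))%N in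
  let t := (base k, base 2) in
  let t := elim j y (elim i x t) in
  let x := elim k t x in let y := elim k t y in
  (k, [:: x.2; y.2; t.2]).

Definition find_base (u v : vec) (c : nat * seq vec) (j : nat) : vec :=
  let ok x := veq (comb u v (base c.1) x) (base j) in
  nth (zero, zero, zero) c.2 (find ok c.2).

(* The three vectors found express the three base vectors as combinations of
   u, v and [base k]; the coefficient of [base k] in the expression of any w
   in [s] is then either zero or invertible. *)
Definition good (s : seq vec) (u v : vec) : bool :=
  let c := certificate u v in
  let x0 := find_base u v c 0 in
  let x1 := find_base u v c 1 in
  let x2 := find_base u v c 2 in
  [&& veq (comb u v (base c.1) x0) (base 0),
      veq (comb u v (base c.1) x1) (base 1),
      veq (comb u v (base c.1) x2) (base 2) &
      all (fun w : vec => let: (a, b, d) := w in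
        let q := add (mul x0.2 a) (add (mul x1.2 b) (mul x2.2 d)) in
        eqq q zero || eqq (mul q (inv q)) one) s].

Definition unit_quat (g : Q8) : quat :=
  let s := if g.1 then -1 else 1 in
  match g.2 with
  | qe => (s, 0, 0, 0) | qi => (0, s, 0, 0)
  | qj => (0, 0, s, 0) | qk => (0, 0, 0, s)
  end.

Definition col (t : nat * Q8) : vec :=
  let q := unit_quat t.2 in
  match t.1 with
  | 0%N => (opp one, q, zero) | 1%N => (zero, opp one, q)
  | 2%N => (q, zero, opp one)
  | 3%N => (one, one, one) | n => base (n - 4)
  end.

Definition all_col : seq vec :=
  let Q := [seq (b, u) | b <- [:: false; true], u <- [:: qe; qi; qj; qk]] in
  [seq col (i, g) | i <- [:: 0; 1; 2]%N, g <- Q]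
  ++ [seq col (i, (false, qe)) | i <- [:: 3; 4; 5; 6]%N].

Lemma all_good :
  all (fun u => all (fun v => veq u v || good all_col u v) all_col) all_col.
Proof. by vm_compute. Qed.

Lemma all_col_neq :
  all (fun u => has (fun v => ~~ veq u v) all_col) all_col.
Proof. by vm_compute. Qed.

End ZQuat.

Section Evenness.
Variables (F : fieldType) (z : F).
Hypotheses (z2 : z * z = -1) (F7 : 7%N \in [pchar F]).

Import ZQuat.

Let zr (n : Z) : F := (int_of_Z n)%:~R.

Let phi (q : quat) : 'M[F]_2 :=
  let: (a, b, c, d) := q in
  mx2 (zr a + zr b * z) (- zr c - zr d * z) (zr c - zr d * z) (zr a - zr b * z).

Let vblk (u : vec) : 'M[F]_(6, 2) :=
  let: (a, b, c) := u in stack (phi a) (phi b) (phi c).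

Lemma zrD m n : zr (Z.add m n) = zr m + zr n.
Proof. by rewrite /zr -intrD -rmorphD. Qed.

Lemma zrM m n : zr (Z.mul m n) = zr m * zr n.
Proof. by rewrite /zr -intrM -rmorphM. Qed.

Lemma zrN m : zr (Z.opp m) = - zr m.
Proof. by rewrite /zr -mulrNz -rmorphN. Qed.

Lemma zr0 : zr Z0 = 0. Proof. by []. Qed.
Lemma zr1 : zr (Zpos xH) = 1. Proof. by []. Qed.

Lemma zr_mod n : zr (Z.modulo n 7) = zr n.
Proof.
have zr7 : zr (Zpos 7) = 0 by exact: (pcharf0 F7).
by rewrite {2}(Z.div_mod n 7) // zrD zrM zr7 mul0r add0r.
Qed.

Lemma phiD p q : phi (add p q) = phi p + phi q.
Proof.
case: p => [[[a b] c] d]; case: q => [[[a' b'] c'] d'].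
by apply/matrixP => -[[|[|i]] Hi] // [[|[|j]] Hj] //; rewrite !mxE /= !zrD; ring.
Qed.

Lemma phiM p q : phi (mul p q) = phi p *m phi q.
Proof.
case: p => [[[a b] c] d]; case: q => [[[a' b'] c'] d'].
apply/matrixP => -[[|[|i]] Hi] // [[|[|j]] Hj] //;
  rewrite !mxE !big_ord_recl big_ord0 /= !mxE /= ?(zrD, zrM, zrN) /Z.sub
    ?(zrD, zrM, zrN); ring: z2.
Qed.

Lemma phi0 : phi zero = 0.
Proof.
by apply/matrixP => -[[|[|i]] Hi] // [[|[|j]] Hj] //; rewrite !mxE /= !zr0; ring.
Qed.

Lemma phi1 : phi one = 1%:M.
Proof.
by apply/matrixP => -[[|[|i]] Hi] // [[|[|j]] Hj] //; rewrite !mxE /= zr0 ?zr1; ring.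
Qed.

Lemma phi_eqq p q : eqq p q -> phi p = phi q.
Proof.
case: p => [[[a b] c] d]; case: q => [[[a' b'] c'] d'] /and4P [].
move=> /Z.eqb_eq ea /Z.eqb_eq eb /Z.eqb_eq ec /Z.eqb_eq ed.
rewrite /phi -(zr_mod a) -(zr_mod b) -(zr_mod c) -(zr_mod d) ea eb ec ed.
by rewrite !zr_mod.
Qed.

Lemma vblk_eq u v : veq u v -> vblk u = vblk v.
Proof.
case: u => [[a b] c]; case: v => [[a' b'] c'] /and3P [].
by move=> /phi_eqq /= -> /phi_eqq -> /phi_eqq ->.
Qed.

Lemma stackD A B C A' B' C' :
  stack (A + A') (B + B') (C + C') = stack A B C + stack A' B' C' :> 'M[F]_(6, 2).
Proof.
rewrite /stack [RHS](@add_col_mx _ 2 4 2).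
apply: (congr2 (@col_mx F 2 4 2)) => //.
by rewrite [RHS](@add_col_mx _ 2 2 2).
Qed.

Lemma stackM A B C D :
  stack (A *m D) (B *m D) (C *m D) = stack A B C *m D :> 'M[F]_(6, 2).
Proof.
rewrite /stack [RHS](@mul_col_mx _ 2 4 2 2).
apply: (congr2 (@col_mx F 2 4 2)) => //.
by rewrite [RHS](@mul_col_mx _ 2 2 2 2).
Qed.

Lemma vblkD u v : vblk (vadd u v) = vblk u + vblk v.
Proof.
case: u => [[a b] c]; case: v => [[a' b'] c'].
by rewrite /vblk /= !phiD stackD.
Qed.

Lemma vblkM u q : vblk (vmulr u q) = vblk u *m phi q.
Proof. by case: u => [[a b] c]; rewrite /vblk /= !phiM stackM. Qed.

Lemma vblk_comb u v w a b c :
  vblk (comb u v w (a, b, c)) =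
  vblk u *m phi a + (vblk v *m phi b + vblk w *m phi c).
Proof. by rewrite /comb !vblkD !vblkM. Qed.

Lemma vblk_baseE :
  [/\ vblk (base 0) = stack 1%:M 0 0, vblk (base 1) = stack 0 1%:M 0 &
      vblk (base 2) = stack 0 0 1%:M].
Proof. by rewrite -phi0 -phi1. Qed.

Lemma vblk_base a b c :
  vblk (a, b, c) = vblk (base 0) *m phi a + vblk (base 1) *m phi b
                   + vblk (base 2) *m phi c.
Proof.
have [-> -> ->] := vblk_baseE.
by rewrite -!stackM -!stackD !mul0mx !mul1mx !addr0 !add0r.
Qed.

Let sp (u : vec) : 'M[F]_(2, 6) := (vblk u)^T.

Lemma sp_full m (S : 'M[F]_(m, 6)) :
  (sp (base 0) <= S)%MS -> (sp (base 1) <= S)%MS -> (sp (base 2) <= S)%MS ->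
  \rank S = 6%N.
Proof.
move=> s0 s1 s2; apply/eqP; rewrite -[_ == _]/(row_full S) -sub1mx.
have -> : (1%:M : 'M[F]_6) =
  (row_mx (vblk (base 0)) (row_mx (vblk (base 1)) (vblk (base 2)) : 'M_(6, 4)))^T.
  have [-> -> ->] := vblk_baseE; rewrite -[LHS]trmx1; congr (_^T).
  rewrite [LHS](@scalar_mx_block _ 2 4) block_mxEh.
  apply: (congr2 (@row_mx F 6 2 4)); first by rewrite -(@col_mx0 _ 2 2 2).
  rewrite (@scalar_mx_block _ 2 2) block_mxEh -(@row_mx0 _ 2 2 2).
  apply: etrans (esym (@block_mxEv F 2 4 2 2 _ _ _ _)) _.
  by rewrite (@block_mxEh F 2 4 2 2).
rewrite (@tr_row_mx _ 6 2 4) (@tr_row_mx _ 6 2 2).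
by rewrite (@col_mx_sub _ 2 4) (@col_mx_sub _ 2 2) s0 s1 s2.
Qed.

Lemma goodP u v : good all_col u v ->
  [/\ \rank (sp u) = 2%N, \rank (sp u + sp v)%MS = 4%N &
     forall w, w \in all_col ->
       (sp w <= sp u + sp v)%MS \/ \rank (sp u + sp v + sp w)%MS = 6%N].
Proof.
rewrite /good; set c := certificate u v.
move: (find_base _ _ _ 0) (find_base _ _ _ 1) (find_base _ _ _ 2).
move=> [[a0 b0] c0] [[a1 b1] c1] [[a2 b2] c2] /and4P [].
move=> /vblk_eq; rewrite vblk_comb => e0.
move=> /vblk_eq; rewrite vblk_comb => e1.
move=> /vblk_eq; rewrite vblk_comb => e2 /allP all_w.
have sp_comb a b d : (((vblk u *m phi a + (vblk v *m phi b +
    vblk (base c.1) *m phi d))^T : 'M_(2, 6)) <= sp u + sp v + sp (base c.1))%MS.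
  rewrite !linearD /= !trmx_mul addrA.
  by rewrite addmx_sub_adds ?addmx_sub_adds ?submxMl.
have full : \rank (sp u + sp v + sp (base c.1))%MS = 6%N.
  by apply: sp_full; rewrite /sp -?e0 -?e1 -?e2; exact: sp_comb.
have le_uv : (\rank (sp u + sp v)%MS <= \rank (sp u) + \rank (sp v))%N.
  exact: mxrank_adds_leqif.
have le_uvk : (\rank (sp u + sp v + sp (base c.1))%MS <=
    \rank (sp u + sp v)%MS + \rank (sp (base c.1)))%N.
  exact: mxrank_adds_leqif.
have := rank_leq_row (sp u); have := rank_leq_row (sp v).
have := rank_leq_row (sp (base c.1)); rewrite full in le_uvk => k2 v2 u2.
split; [lia | lia |].
move=> [[a b] d] /all_w; set q := add _ _ => q_unit.
have vw : exists X Y, vblk (a, b, d) =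
    vblk u *m X + vblk v *m Y + vblk (base c.1) *m phi q.
  exists (phi a0 *m phi a + phi a1 *m phi b + phi a2 *m phi d).
  exists (phi b0 *m phi a + phi b1 *m phi b + phi b2 *m phi d).
  rewrite vblk_base -e0 -e1 -e2 /q !phiD !phiM !mulmxDr !mulmxDl !mulmxA.
  by rewrite !addrA [LHS](ACl (1*4*7*2*5*8*3*6*9)).
have {vw} [X [Y vw]] := vw.
case/orP: q_unit => [/phi_eqq|/phi_eqq]; rewrite ?phi0 ?phi1 ?phiM => eq.
  left; rewrite /sp vw eq mulmx0 addr0 linearD /= !trmx_mul.
  by rewrite addmx_sub_adds ?submxMl.
right; apply/eqP; rewrite eqn_leq rank_leq_col -[X in (X <= _)%N]full mxrankS //.
rewrite addsmx_sub addsmxSl /=.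
have -> : sp (base c.1) = (phi (inv q))^T *m sp (a, b, d)
    - (X *m phi (inv q))^T *m sp u - (Y *m phi (inv q))^T *m sp v.
  rewrite /sp -!trmx_mul -!linearB /=; apply: (congr1 trmx).
  rewrite -[stack _ _ _]/(vblk (a, b, d)).
  by rewrite vw !mulmxDl -!mulmxA eq mulmx1 -addrA -opprD addrAC subrr add0r.
rewrite !addmx_sub // ?eqmx_opp.
- exact: submx_trans (submxMl _ _) (addsmxSr _ _).
- apply: submx_trans (submxMl _ _) _.
  exact: submx_trans (addsmxSl _ _) (addsmxSl _ _).
- apply: submx_trans (submxMl _ _) _.
  exact: submx_trans (addsmxSr _ _) (addsmxSl _ _).
Qed.

Let zcol (e : ground) : vec :=
  match e with
  | Pt i => col ((4 + i)%N, (false, qe))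
  | El g i => col (nat_of_ord i, g)
  | OO => col (3%N, (false, qe))
  end.

Lemma zcolP e : zcol e \in all_col.
Proof.
case: e => [i|g i|] /=; rewrite mem_cat; apply/orP.
- right; apply: (map_f (fun i => col (i, (false, qe)))).
  by case: i => [[|[|[|i]]] Hi].
- left; apply/allpairsP; exists (nat_of_ord i, g); split=> //=.
    by case: i => [[|[|[|i]]] Hi].
  by case: g => [[] []]; rewrite !in_cons eqxx ?orbT.
- by right; apply: (map_f (fun i => col (i, (false, qe)))).
Qed.

Lemma phi_unit g : phi (unit_quat g) = rho z g.
Proof.
case: g => [[] []]; apply/matrixP => -[[|[|i]] Hi] // [[|[|j]] Hj] //;
  by rewrite !mxE /= ?(zr0, zr1) -?[Zneg 1]/(Z.opp (Zpos xH)) ?zrN ?zr1; ring.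
Qed.

Lemma phi_opp1 : phi (opp one) = - 1%:M.
Proof.
by apply/matrixP => -[[|[|i]] Hi] // [[|[|j]] Hj] //;
  rewrite !mxE /= ?(zr0, zr1) -?[Zneg 1]/(Z.opp (Zpos xH)) ?zrN ?zr1; ring.
Qed.

Lemma Astar_vblk e : Astar z e = vblk (zcol e).
Proof.
case: e => [[[|[|[|i]]] Hi]|g [[|[|[|i]]] Hi]|] //=;
by rewrite -?phi_opp1 -?phi_unit -?phi0 -?phi1.
Qed.

Lemma good_col u v : u \in all_col -> v \in all_col -> ~~ veq u v ->
  good all_col u v.
Proof.
move=> ua va; have /allP /(_ _ ua) /allP /(_ _ va) := all_good.
by case: (veq u v).
Qed.

Lemma Astar_even X : (2 %| block_rank (Astar z) X)%N.
Proof.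
pose S : 'M[F]_6 := (\sum_(e in X) <<(Astar z e)^T>>)%MS.
rewrite block_rankE -/S.
have sS e : e \in X -> (sp (zcol e) <= S)%MS.
  by move=> eX; apply: (sumsmx_sup e) => //; rewrite genmxE Astar_vblk.
have subS m (T : 'M[F]_(m, 6)) :
    (forall e, e \in X -> (sp (zcol e) <= T)%MS) -> (S <= T)%MS.
  by move=> sT; apply/sumsmx_subP => e eX; rewrite genmxE Astar_vblk sT.
have rkS m (T : 'M[F]_(m, 6)) : (S <= T)%MS -> (T <= S)%MS -> \rank S = \rank T.
  by move=> s1 s2; apply/eqP; rewrite eqn_leq !mxrankS.
have [X0 | [e eX]] := set_0Vmem X.
  by rewrite /S X0 big_set0 mxrank0.
have [/forall_inP all_e|] :=
  boolP [forall (f | f \in X), veq (zcol e) (zcol f)].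
  rewrite (rkS _ (sp (zcol e))) ?sS //; last first.
    by apply: subS => f /all_e /vblk_eq; rewrite /sp => ->.
  have /allP /(_ _ (zcolP e)) /hasP [v va nv] := all_col_neq.
  by have [-> _ _] := goodP (good_col (zcolP e) va nv).
rewrite negb_forall_in => /exists_inP [f fX nef].
have [_ r4 uv] := goodP (good_col (zcolP e) (zcolP f) nef).
have sef : (sp (zcol e) + sp (zcol f) <= S)%MS by rewrite addsmx_sub !sS.
have [/forall_inP all_g|] :=
  boolP [forall (g | g \in X), (sp (zcol g) <= sp (zcol e) + sp (zcol f))%MS].
  by rewrite (rkS _ (sp (zcol e) + sp (zcol f))%MS) ?r4 //; apply: subS.
rewrite negb_forall_in => /exists_inP [g gX ng].
case: (uv _ (zcolP g)) => [sg|r6]; first by rewrite sg in ng.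
suff -> : \rank S = 6%N by [].
by apply/eqP; rewrite eqn_leq rank_leq_col -[X in (X <= _)%N]r6 mxrankS // addsmx_sub sef sS.
Qed.

End Evenness.

Lemma prim4_sqr (F : fieldType) (z : F) : 4.-primitive_root z -> z * z = -1.
Proof.
move=> z4; have /eqP := prim_expr_order z4.
rewrite (exprM z 2 2) sqrf_eq1 -(prim_order_dvd z4) /=.
by move/eqP; rewrite expr2.
Qed.

Lemma card49_pchar (F : finFieldType) : #|F| = 49%N -> 7%N \in [pchar F].
Proof. by move=> F49; apply: (@card_finPcharP _ _ 2). Qed.

Definition QNF3_Q8 (F : finFieldType) (F49 : #|F| = 49%N)
    (z : F) (z4 : 4.-primitive_root z) : matroid ground :=
  klinear_matroid (Astar_even (prim4_sqr z4) (card49_pchar F49)).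

Lemma QNF3_Q8P (F : finFieldType) (F49 : #|F| = 49%N)
    (z : F) (z4 : 4.-primitive_root z) :
  klinear_representation (Astar z) (QNF3_Q8 F49 z4).
Proof. exact: klinear_matroidP. Qed.

(* Main.v *)
(* Let q be the exponential characteristic of K.  Every circuit of the matroid
   carries a polynomial relation which, after its elements are raised to suitable
   powers q^e, has all its partial derivatives nonzero: it then yields a linear
   relation between differentials with all coefficients nonzero.  Normalise the
   points p_1, p_2, p_3, O by their circuit.  The relation of p_i, p_{i+1}, g^(i)
   then involves exponents whose difference delta_i(g) measures how far the
   normalisations disagree.  By the Jacobian criterion the collinearities
   p_{i+2}, O, (-e)^(i) give delta_i(-e) = 0, and the collinearities of g^(1),
   h^(2), k^(3) with hgk = e give delta_1(g) + delta_2(h) + delta_3(k) = 0, so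
   that delta = 0, as Z has no torsion.  Hence the differentials define functions
   F_i from Q8 to a multiplicative group of scalars with F_i(-e) = -1, and with
   F_1(g) F_2(h) F_3(k) = 1 whenever hgk = e.  Since ij = (-e)ji while scalars
   commute, this forces -1 = 1. *)
From HB Require Import structures.
From Stdlib Require Import Classical ClassicalEpsilon.
Require Import Defs.
From mathcomp Require Import all_boot all_order all_algebra all_fingroup all_field.
From mathcomp Require Import mpoly ring zify.

Set Implicit Arguments.
Unset Strict Implicit.
Unset Printing Implicit Defensive.

Import GRing.Theory.

Local Open Scope ring_scope.

(** * Derivations *)

(** The obstacle is inseparability. A derivation on the field generated by the points need not
    extend to [L], and in positive characteristic the differential of a [q]-th power vanishes, so a
    relation carries linear information only relative to coordinates raised to the right powers.
    Hence a differential is recorded by a polynomial relation ([gradient]) over explicit powers of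
    the points, and derivations live on subfields enlarged by one separable element at a time.
    Frobenius moves a relation up but not down, so relations are compared at a common high level. A
    coordinate kept below the power that a relation demands gets coefficient zero; this is how the
    Jacobian criterion yields equations between exponents: unequal exponents would leave exactly one
    nonzero term in an expression that must vanish. Only once delta = 0 do the relations of all
    g^(i) have nonzero coefficients in one coordinate system. In characteristic 0 there is nothing
    to align: [q = 1] and Frobenius is the identity. *)

Lemma mpoly_ring_ind n (R : comNzRingType) (T : {mpoly R[n]} -> Prop) :
  (forall c, T c%:MP) -> (forall i, T 'X_i) ->
  (forall p r, T p -> T r -> T (p + r)) ->
  (forall p r, T p -> T r -> T (p * r)) -> forall p, T p.
Proof.
move=> TC TX TD TM p; rewrite (mpolyE p).
apply: (big_rec T) => [|m x _ Tx]; first by rewrite -mpolyC0.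
apply: (TD) => //; rewrite -mul_mpolyC; apply: (TM) => //; rewrite mpolyXE_id.
apply: (big_rec T) => [|i y _ Ty]; first by rewrite -mpolyC1.
apply: (TM) => //; elim: (m i) => [|k IH]; first by rewrite expr0 -mpolyC1.
by rewrite exprS; apply: (TM).
Qed.

Section Subring.
Variables (A : comNzRingType) (S : A -> Prop).

Record subring : Prop := Subring {
  subring1 : S 1;
  subringB : forall a b, S a -> S b -> S (a - b);
  subringM : forall a b, S a -> S b -> S (a * b)
}.

Hypothesis sS : subring.

Lemma subring0 : S 0. Proof. by rewrite -(subrr 1); apply: subringB => //; apply: subring1. Qed.
Lemma subringN a : S a -> S (- a).
Proof. by move=> Sa; rewrite -sub0r; apply: subringB => //; apply: subring0. Qed.
Lemma subringD a b : S a -> S b -> S (a + b).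
Proof. by move=> Sa Sb; rewrite -(opprK b); apply: subringB => //; apply: subringN. Qed.
Lemma subring_sum I (r : seq I) (P : pred I) F :
  (forall i, P i -> S (F i)) -> S (\sum_(i <- r | P i) F i).
Proof. by move=> SF; apply: big_ind => //; [apply: subring0 | apply: subringD]. Qed.
Lemma subringX a k : S a -> S (a ^+ k).
Proof.
move=> Sa; elim: k => [|k IH]; first exact: (subring1 sS).
by rewrite exprS; apply: subringM.
Qed.
End Subring.

Lemma subfield_subring (L : fieldType) (F : L -> Prop) :
  is_subfield F -> subring F.
Proof. by case. Qed.

Section Derivation.
Variables (A : comNzRingType) (L : fieldType).

(** The evaluation [ev] is a parameter so that one notion covers derivations of a subfield of [L],
    with [ev] the identity, and derivations of a polynomial ring into [L], with [ev] a
    substitution. *)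
Record derivation (S : A -> Prop) (ev d : A -> L) : Prop := Derivation {
  derivationB : forall a b, S a -> S b -> d (a - b) = d a - d b;
  derivationM : forall a b, S a -> S b -> d (a * b) = d a * ev b + ev a * d b
}.

Variables (S : A -> Prop) (ev : {rmorphism A -> L}) (d : A -> L).
Hypotheses (sS : subring S) (der_d : derivation S ev d).

Lemma derivation0 : d 0 = 0.
Proof. by rewrite -(subrr 1) (derivationB der_d) ?subrr //; apply: subring1. Qed.

Lemma derivationN a : S a -> d (- a) = - d a.
Proof.
by move=> Sa; rewrite -sub0r (derivationB der_d) // ?derivation0 ?sub0r //; apply: subring0.
Qed.

Lemma derivationD a b : S a -> S b -> d (a + b) = d a + d b.
Proof.
by move=> Sa Sb; rewrite -{1}(opprK b) (derivationB der_d) ?derivationN ?opprK //; apply: subringN.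
Qed.

Lemma derivation_sum I (r : seq I) (P : pred I) F :
  (forall i, P i -> S (F i)) ->
  d (\sum_(i <- r | P i) F i) = \sum_(i <- r | P i) d (F i).
Proof.
move=> SF; suff: S (\sum_(i <- r | P i) F i) /\
  d (\sum_(i <- r | P i) F i) = \sum_(i <- r | P i) d (F i) by case.
apply: (big_rec2 (fun x y => S x /\ d x = y)) => [|i y x Pi [Sx dx]].
  by split; [exact: subring0 | exact: derivation0].
by split; [apply: subringD; auto | rewrite derivationD ?dx; auto].
Qed.

Lemma derivation1 : d 1 = 0.
Proof.
have := derivationM der_d (subring1 sS) (subring1 sS).
by rewrite !mulr1 rmorph1 mulr1 mul1r => /eqP; rewrite -subr_eq0 opprD addrA subrr sub0r oppr_eq0 => /eqP.
Qed.

Lemma derivationX a k : S a -> d (a ^+ k) = k%:R * ev a ^+ k.-1 * d a.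
Proof.
move=> Sa; elim: k => [|k IH]; first by rewrite expr0 derivation1 !mul0r.
rewrite exprS (derivationM der_d) //; last exact: subringX.
rewrite IH rmorphXn; case: k {IH} => [|k]; first by rewrite !expr0; ring.
by rewrite /= !exprS -[k.+2%:R]natr1; ring.
Qed.

(** The chain rule. Membership in [S] is carried through the induction because the rules for [d]
    hold only inside [S]. *)
Lemma mmap_derivation (K : fieldType) n (h : {rmorphism K -> A}) (v : 'I_n -> A) :
  (forall c, S (h c)) -> (forall c, d (h c) = 0) -> (forall i, S (v i)) ->
  forall P, S (mmap h v P) /\
    d (mmap h v P) = \sum_i ev (mmap h v P^`M(i)) * d (v i).
Proof.
move=> Sh dh Sv; apply: mpoly_ring_ind => [c|i|p r [Sp dp] [Sr dr]
    |p r [Sp dp] [Sr dr]].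
- split; first by rewrite mmapC; apply: (Sh).
  by rewrite mmapC dh big1 // => i _; rewrite mderivC mmap0 rmorph0 mul0r.
- have mX j : mmap h v 'X_j = v j by rewrite mmapX mmap1U.
  rewrite mX; split=> //; rewrite (bigD1 i) //= mderivX mnm1E eqxx scale1r.
  have -> : (U_(i) - U_(i) = 0 :> 'X_{1..n})%MM by rewrite -{1}[U_(i)%MM]add0m addmK.
  rewrite mpolyX0 rmorph1 rmorph1 mul1r big1 ?addr0 // => j ji.
  by rewrite mderivX mnm1E eq_sym (negPf ji) scale0r mmap0 rmorph0 mul0r.
- rewrite rmorphD /=; split; first exact: subringD.
  rewrite derivationD // dp dr -big_split; apply: eq_bigr => i _ /=.
  by rewrite mderivD rmorphD rmorphD mulrDl.
- rewrite rmorphM /=; split; first exact: subringM.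
  rewrite (derivationM der_d) // dp dr mulr_suml mulr_sumr -big_split.
  by apply: eq_bigr => i _ /=; rewrite mderivM rmorphD !rmorphM rmorphD !rmorphM /=; ring.
Qed.

End Derivation.

(** * Descending derivations to fields of fractions *)

Ltac in_subring := do 6? first [done | apply: subringB | apply: subringM].

Section Fraction.
Variables (A : comNzRingType) (L : fieldType).
Variables (S : A -> Prop) (ev : {rmorphism A -> L}) (d : A -> L).
Hypotheses (sS : subring S) (der_d : derivation S ev d).
Hypothesis d_ker : forall a, S a -> ev a = 0 -> d a = 0.

Definition fraction_of (x : L) : Prop :=
  exists a b, [/\ S a, S b, ev b != 0 & x = ev a / ev b].

Lemma fraction_of_subfield : is_subfield fraction_of.
Proof.
split.
- by exists 1, 1; rewrite rmorph1 divr1 oner_neq0; split=> //; apply: subring1.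
- move=> _ _ [a [b [Sa Sb b0 ->]]] [a' [b' [Sa' Sb' b0' ->]]].
  exists (a * b' - a' * b), (b * b'); split; try by in_subring.
    by rewrite rmorphM mulf_neq0.
  by rewrite rmorphB !rmorphM; field; rewrite b0 b0'.
- move=> _ _ [a [b [Sa Sb b0 ->]]] [a' [b' [Sa' Sb' b0' ->]]].
  exists (a * a'), (b * b'); split; try by in_subring.
    by rewrite rmorphM mulf_neq0.
  by rewrite !rmorphM; field; rewrite b0 b0'.
- move=> _ [a [b [Sa Sb b0 ->]]].
  have [a0|a0] := eqVneq (ev a) 0.
    exists 0, 1; rewrite a0 mul0r invr0 rmorph0 rmorph1 mul0r oner_neq0.
    by split=> //; [apply: subring0 | apply: subring1].
  by exists b, a; rewrite invf_div.
Qed.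

Lemma mem_fraction_of a : S a -> fraction_of (ev a).
Proof.
by move=> Sa; exists a, 1; rewrite rmorph1 divr1 oner_neq0; split=> //; apply: subring1.
Qed.

(** [D] is the quotient rule applied to a chosen fraction. Independence of the choice is where
    [d_ker] enters: for two fractions of equal value it is applied to [a * b' - a' * b]. *)
Lemma fraction_derivation : exists D : L -> L,
  derivation fraction_of idfun D /\ forall a, S a -> D (ev a) = d a.
Proof.
pose rep x (ab : A * A) :=
  [/\ S ab.1, S ab.2, ev ab.2 != 0 & x = ev ab.1 / ev ab.2].
pose q (ab : A * A) := (d ab.1 - ev ab.1 / ev ab.2 * d ab.2) / ev ab.2.
pose D x := q (epsilon (inhabits (0, 1)) (rep x)).
have qE x ab ab' : rep x ab -> rep x ab' -> q ab = q ab'.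
  case: ab ab' => [a b] [a' b'] [/= Sa Sb b0 ->] [/= Sa' Sb' b0' e].
  rewrite /q /= -e; set x' := ev a / ev b.
  have ea : ev a = x' * ev b by rewrite divfK.
  have ea' : ev a' = x' * ev b' by rewrite /x' e divfK.
  have := d_ker (subringB sS (subringM sS Sa Sb') (subringM sS Sa' Sb)).
  rewrite (derivationB der_d) ?(derivationM der_d) ?rmorphB ?rmorphM; try by in_subring.
  rewrite ea ea' => /(_ _) H; apply/eqP; rewrite eqr_div //; apply/eqP.
  apply/eqP; rewrite -subr_eq0; apply/eqP; rewrite -[RHS]H; ring.
have DE a b : S a -> S b -> ev b != 0 -> D (ev a / ev b) = q (a, b).
  move=> Sa Sb b0; have r : rep (ev a / ev b) (a, b) by [].
  by apply: (qE _ _ _ _ r); apply: epsilon_spec; exists (a, b).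
exists D; split; last first.
  move=> a Sa; rewrite -[ev a]divr1 -(rmorph1 ev) DE ?rmorph1 ?oner_neq0 //.
    by rewrite /q /= (derivation1 sS der_d) rmorph1 mulr0 subr0 divr1.
  exact: (subring1 sS).
split.
- move=> _ _ [a [b [Sa Sb b0 ->]]] [a' [b' [Sa' Sb' b0' ->]]].
  have -> : ev a / ev b - ev a' / ev b' = ev (a * b' - a' * b) / ev (b * b').
    by rewrite rmorphB !rmorphM; field; rewrite b0 b0'.
  rewrite !DE ?rmorphM ?mulf_neq0 //; try by in_subring.
  rewrite /q /= (derivationB der_d) ?(derivationM der_d) ?rmorphB ?rmorphM;
    try by in_subring.
  by rewrite /=; field; rewrite b0 b0'.
- move=> _ _ [a [b [Sa Sb b0 ->]]] [a' [b' [Sa' Sb' b0' ->]]] /=.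
  have -> : ev a / ev b * (ev a' / ev b') = ev (a * a') / ev (b * b').
    by rewrite !rmorphM; field; rewrite b0 b0'.
  rewrite !DE ?rmorphM ?mulf_neq0 //; try by in_subring.
  by rewrite /q /= !(derivationM der_d) ?rmorphM //; field; rewrite b0 b0'.
Qed.

End Fraction.

(** * Extending derivations along separable elements *)

Lemma ex_minimal (T : Type) (P : T -> Prop) (m : T -> nat) :
  (exists x, P x) -> exists x, P x /\ forall y, P y -> (m x <= m y)%N.
Proof.
move=> [x]; have [n] := ubnP (m x); elim: n x => // n IH x ltn Px.
have [[y [Py lty]]|nex] := classic (exists y, P y /\ (m y < m x)%N).
  by apply: (IH y) => //; lia.
exists x; split=> // y Py; rewrite leqNgt; apply/negP => lty.
by apply: nex; exists y.
Qed.

Section SeparableExtension.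
Variables (L : fieldType) (F : L -> Prop).
Hypothesis sF : is_subfield F.

Definition poly_over (q : {poly L}) : Prop := forall i, F q`_i.

Let sF' : subring F := subfield_subring sF.

Lemma poly_over_subring : subring poly_over.
Proof.
split.
- by move=> i; rewrite coef1; case: eqP => _; [apply: subring1 | apply: subring0].
- by move=> a b Fa Fb i; rewrite coefB; apply: subringB.
- by move=> a b Fa Fb i; rewrite coefM; apply: subring_sum => // j _; apply: subringM.
Qed.

Lemma poly_overZXn c k : F c -> poly_over (c *: 'X^k).
Proof.
move=> Fc i; rewrite coefZ coefXn; case: eqP => _; rewrite ?mulr1 ?mulr0 //.
exact: subring0.
Qed.

Lemma deriv_derivation (y : L) :
  derivation poly_over (horner_eval y) (fun q => q^`().[y]).
Proof.
split=> a b _ _; rewrite /horner_eval; first by rewrite derivB !hornerE.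
by rewrite derivM !hornerE.
Qed.

Variable D : L -> L.
Hypothesis der_D : derivation F idfun D.

Lemma coef_map_der (q : {poly L}) i : (map_poly D q)`_i = D q`_i.
Proof. by rewrite coef_map_id0 //; apply: derivation0 der_D. Qed.

(** This is the extension of [D] to polynomials that gives the variable the value [u], followed by
    evaluation at [y]. *)
Lemma map_poly_derivation (y u : L) :
  derivation poly_over (horner_eval y)
    (fun q => (map_poly D q).[y] + q^`().[y] * u).
Proof.
have [dB dM] := deriv_derivation y.
split=> a b Fa Fb.
  have -> : map_poly D (a - b) = map_poly D a - map_poly D b.
    by apply/polyP => i; rewrite coefB !coef_map_der coefB (derivationB der_D).
  by rewrite dB // hornerD hornerN; ring.
have -> : map_poly D (a * b) = map_poly D a * b + a * map_poly D b.
  apply/polyP => i; rewrite coefD !coefM coef_map_der coefM.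
  rewrite (derivation_sum sF' der_D) => [|j _]; last exact: subringM.
  rewrite -big_split; apply: eq_bigr => j _ /=.
  by rewrite (derivationM der_D) // !coef_map_der.
by rewrite dM // !hornerE /horner_eval; ring.
Qed.

(** Every polynomial over [F] vanishing at [y] is a multiple of [g], and [d (a * g) = d a * g.[y] +
    a.[y] * d g = 0]. The division is carried out one leading term at a time, by induction on the
    size. *)
Lemma derivation_ker_min (y : L) (g : {poly L}) (d : {poly L} -> L) :
  g != 0 -> poly_over g -> g.[y] = 0 ->
  (forall q, [/\ q != 0, poly_over q & q.[y] = 0] -> (size g <= size q)%N) ->
  derivation poly_over (horner_eval y) d -> d g = 0 ->
  forall q, poly_over q -> q.[y] = 0 -> d q = 0.
Proof.
move=> g0 Fg gy gmin der_d dg q.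
have sP := poly_over_subring.
have [n] := ubnP (size q); elim: n q => // n IH q ltn Fq qy.
have [->|q0] := eqVneq q 0; first exact: derivation0 sP der_d.
have le_gq : (size g <= size q)%N by exact: gmin.
pose k := (size q - size g)%N.
pose a := (lead_coef q / lead_coef g) *: 'X^k.
have Fa : poly_over a.
  apply: poly_overZXn; apply: (subringM sF'); first exact: Fq.
  by apply: (subfieldV sF); exact: Fg.
have sg : (0 < size g)%N by rewrite size_poly_gt0.
have lt_size : (size (q - a * g)%R < size q)%N.
  rewrite -(prednK (leq_trans sg le_gq)) ltnS; apply/leq_sizeP => j lej.
  rewrite coefB /a -scalerAl coefZ coefXnM.
  have -> : (j < k)%N = false by rewrite /k; lia.
  have [->|ne] := eqVneq j (size q).-1.
    have -> : ((size q).-1 - k = (size g).-1)%N by rewrite /k; lia.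
    by rewrite -!lead_coefE divfK ?subrr // lead_coef_eq0.
  have lt_j : (size q <= j)%N by move/eqP: ne; lia.
  rewrite (nth_default _ lt_j) nth_default ?mulr0 ?subrr //.
  by move: lt_j le_gq; rewrite /k; move: (size q) (size g); clear; lia.
have d0 : d (q - a * g) = 0.
  apply: IH; first by lia.
    by apply: (subringB sP) => //; apply: (subringM sP).
  by rewrite hornerD hornerN hornerM gy qy mulr0 subr0.
have := derivationB der_d Fq (subringM sP Fa Fg).
by rewrite d0 (derivationM der_d) // dg /horner_eval gy !mulr0 addr0 subr0 => <-.
Qed.

Lemma separable_extension (y : L) (f : {poly L}) :
  poly_over f -> f.[y] = 0 -> f^`().[y] != 0 ->
  exists (F' : L -> Prop) (D' : L -> L),
    [/\ is_subfield F', derivation F' idfun D', forall x, F x -> F' x, F' y &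
        forall x, F x -> D' x = D x].
Proof.
move=> Ff fy f'y.
have sP := poly_over_subring.
have [|g [[g0 Fg gy] gmin]] :=
    @ex_minimal _ (fun q => [/\ q != 0, poly_over q & q.[y] = 0])
      (fun q : {poly L} => size q).
  by exists f; split=> //; apply: contraNneq f'y => ->; rewrite deriv0 horner0.
(* Otherwise formal differentiation followed by evaluation would kill [g], hence every polynomial
   vanishing at [y], including [f]. *)
have g'y : g^`().[y] != 0.
  apply: contraNneq f'y => g'y; apply/eqP.
  exact: (derivation_ker_min g0 Fg gy gmin (deriv_derivation y)).
(* The value given to [y] is forced by the requirement that [g] be killed. *)
have der_d := map_poly_derivation y (- (map_poly D g).[y] / g^`().[y]).
set d := (fun q : {poly L} => _) in der_d.
have d_ker q : poly_over q -> q.[y] = 0 -> d q = 0.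
  apply: (derivation_ker_min g0 Fg gy gmin der_d).
  by rewrite /d mulrC divfK // subrr.
have [D' [der_D' D'E]] := fraction_derivation sP der_d d_ker.
have FC c : F c -> poly_over c%:P.
  by move=> Fc i; rewrite coefC; case: eqP => // _; apply: subring0.
exists (fraction_of poly_over (horner_eval y)), D'; split=> //.
- exact: fraction_of_subfield.
- move=> x Fx; rewrite -[x](hornerC x y).
  by apply: mem_fraction_of => //; apply: FC.
- rewrite -[X in fraction_of _ _ X](hornerX y).
  apply: mem_fraction_of => // i; rewrite coefX.
  by case: eqP => _; [apply: subring1 | apply: subring0].
- move=> x Fx; rewrite -{1}(hornerC x y) [LHS](D'E _ (FC _ Fx)).
  rewrite /d derivC horner0 mul0r addr0.
  have -> : map_poly D x%:P = (D x)%:P; last by rewrite hornerC.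
  apply/polyP => i; rewrite coef_map_der !coefC.
  by case: eqP => // _; apply: derivation0 der_D.
Qed.

End SeparableExtension.

(** * Separable polynomial relations *)

Lemma mmap_rmorph n (R S T : comNzRingType) (g : {rmorphism S -> T})
    (h : {rmorphism R -> S}) (v : 'I_n -> S) P :
  g (mmap h v P) = mmap (g \o h) (g \o v) P.
Proof.
rewrite /mmap rmorph_sum; apply: eq_bigr => m _; rewrite rmorphM /mmap1 rmorph_prod.
by congr (_ * _); apply: eq_bigr => i _; rewrite rmorphXn.
Qed.

Lemma eq_mmap n (R S : nzRingType) (h h' : R -> S) (v v' : 'I_n -> S) P :
  h =1 h' -> v =1 v' -> mmap h v P = mmap h' v' P.
Proof.
by move=> eh ev; apply: eq_bigr => m _; rewrite eh (mmap1_eq _ ev).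
Qed.

Lemma mmap_lin_sum n m (R S : comNzRingType) (h : {rmorphism R -> S})
    (v : 'I_m -> S) (r : seq 'X_{1..n}) (c : 'X_{1..n} -> R)
    (phi : 'X_{1..n} -> 'X_{1..m}) :
  mmap h v (\sum_(k <- r) c k *: 'X_[phi k]) =
  \sum_(k <- r) h (c k) * \prod_i v i ^+ phi k i.
Proof. by rewrite raddf_sum; apply: eq_bigr => k _; rewrite /= mmapZ mmapX. Qed.

(** * Monomial weights and power substitutions *)

Section MonomialWeight.
Variables (n : nat) (K : fieldType).
Implicit Types P Q : {mpoly K[n]}.

(** The measure of the descents below. The total degree would not do: dividing the exponents of a
    single variable by [q] can leave it unchanged. *)
Definition weight P : nat := \sum_(m <- msupp P) mdeg m.

(** Monomials may merge or cancel under [phi], which only lowers the sum. *)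
Lemma weight_lt P (c : 'X_{1..n} -> K) (phi : 'X_{1..n} -> 'X_{1..n}) m0 :
  (forall m, (mdeg (phi m) <= mdeg m)%N) ->
  m0 \in msupp P -> (mdeg (phi m0) < mdeg m0)%N ->
  (weight (\sum_(m <- msupp P) c m *: 'X_[phi m])%R < weight P)%N.
Proof.
move=> le_phi Pm0 lt_phi; set Q := \sum_(m <- _) _.
have leQ : (weight Q <= \sum_(m <- [seq phi m | m <- msupp P]) mdeg m)%N.
  rewrite /weight; apply: (@sub_le_big_seq nat addn leq) => // [x y|m]; first exact: leq_addr.
  rewrite count_uniq_mem ?msupp_uniq //.
  have [Qm|//] := boolP (m \in msupp Q); rewrite -has_count has_pred1.
  apply: contraLR Qm => Nm; rewrite mcoeff_msupp negbK raddf_sum big1_seq //=.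
  move=> k Pk; rewrite mcoeffZ mcoeffX.
  have [ek|_] := eqVneq (phi k) m; last by rewrite mulr0.
  by rewrite -ek map_f in Nm.
apply: leq_ltn_trans leQ _; rewrite big_map /weight.
rewrite (big_rem m0) //= [X in (_ < X)%N](big_rem m0) //= -addSn.
by rewrite leq_add // leq_sum.
Qed.

End MonomialWeight.

Section PowerSubstitution.
Variables (n : nat) (K : fieldType) (w : 'I_n -> nat).
Implicit Types P Q : {mpoly K[n]}.

Definition power_subst P : {mpoly K[n]} :=
  mmap (@mpolyC n K) (fun i => 'X_i ^+ w i) P.

Lemma mmap_power_subst (L : fieldType) (iota : {rmorphism K -> L}) x P :
  mmap iota x (power_subst P) = mmap iota (fun i => x i ^+ w i) P.
Proof.
rewrite (mmap_rmorph (mmap iota x)); apply: eq_mmap => [c|i] /=.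
  exact: mmapC.
by rewrite rmorphXn /= mmapX mmap1U.
Qed.

Lemma power_subst_eq0 P : (forall i, 0 < w i)%N -> power_subst P = 0 -> P = 0.
Proof.
move=> w_gt0 P0; apply/mpolyP => m; rewrite mcoeff0.
pose s (m : 'X_{1..n}) := [multinom (w i * m i)%N | i < n].
have s_inj : injective s.
  move=> m1 m2 e12; have e := (mnmP _ _).1 e12; apply/mnmP => i; have := e i; rewrite !mnmE => /eqP.
  by rewrite eqn_pmul2l // => /eqP.
have <- : (power_subst P)@_(s m) = P@_m; last by rewrite P0 mcoeff0.
have -> : power_subst P = \sum_(k <- msupp P) (P@_k)%:MP * 'X_[s k].
  rewrite /power_subst /mmap; apply: eq_bigr => k _.
  rewrite /mmap1; congr (_ * _).
  rewrite mpolyXE_id; apply: eq_bigr => i _.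
  by rewrite mnmE exprM.
transitivity (\sum_(k <- msupp P) P@_k * (k == m)%:R).
  rewrite raddf_sum; apply: eq_bigr => k _ /=.
  by rewrite mcoeffCM mcoeffX (inj_eq s_inj).
rewrite [in RHS](mpolyE P) raddf_sum; apply: eq_bigr => k _ /=.
by rewrite mcoeffZ mcoeffX.
Qed.

End PowerSubstitution.

Lemma drop_variable n (K L : fieldType) (iota : {rmorphism K -> L})
    (x : 'I_n.+1 -> L) i (P : {mpoly K[n.+1]}) :
  alg_independent iota (fun j => x (lift i j)) ->
  (forall m, m \in msupp P -> m i = 0%N) -> mmap iota x P = 0 -> P = 0.
Proof.
move=> indep Pi Px.
pose Q := \sum_(m <- msupp P) P@_m *: 'X_[[multinom m (lift i j) | j < n]].
(* Stated for every target ring: it serves for the evaluation in [L] and, with the identity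
   substitution, to recover [P = 0] from [Q = 0]. *)
have eP (S : comNzRingType) (h : {rmorphism K -> S}) (v : 'I_n.+1 -> S) :
    mmap h v P = mmap h (fun j => v (lift i j)) Q.
  rewrite {1}(mpolyE P) !(@mmap_lin_sum _ _ _ _ h).
  apply: eq_big_seq => m Pm; congr (_ * _).
  rewrite (bigD1_ord i) //= Pi // expr0 mul1r.
  by apply: eq_bigr => j _; rewrite mnmE.
have Q0 : Q = 0 by apply: indep; rewrite -eP.
rewrite -[LHS]comp_mpoly_id /comp_mpoly eP Q0; exact: mmap0.
Qed.

(* [q] is the exponential characteristic: 1 in characteristic 0. *)
Record expchar (K : fieldType) (q : nat) : Prop := Expchar {
  expchar_gt0 : (0 < q)%N;
  expchar_eq0 : (1 < q)%N -> q%:R = 0 :> K;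
  expchar_dvd : forall k : nat,
    k%:R = 0 :> K -> k = 0%N \/ (1 < q)%N /\ (q %| k)%N
}.

Section SeparableRelation.
Variables (K : fieldType) (q : nat).
Hypothesis Kq : expchar K q.

Lemma weight_mderiv n (P : {mpoly K[n]}) i :
  P^`M(i) != 0 -> (weight P^`M(i) < weight P)%N.
Proof.
move=> dP0; have [m Pm mi] : exists2 m, m \in msupp P & (0 < m i)%N.
  have [/hasP [m]|/hasPn Ni] := boolP (has (fun m : 'X_{1..n} => 0 < m i)%N (msupp P)).
    by exists m.
  case/eqP: dP0; rewrite /mderiv big1_seq //= => m /Ni.
  by rewrite lt0n negbK => /eqP ->; rewrite mul0r scale0r.
apply: (@weight_lt _ _ _ _ (fun m => m - U_(i))%MM m) => //.
  by move=> k; apply: mdegB.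
have e : (m - U_(i) + U_(i) = m)%MM.
  by rewrite submK //; apply/mnm_lepP => j; rewrite mnm1E; case: eqP => // <-.
by rewrite -{2}e mdegD mdeg1 addn1.
Qed.

Lemma mderiv_eq0_dvd n (P : {mpoly K[n]}) i m :
  P^`M(i) = 0 -> m \in msupp P -> m i = 0%N \/ (1 < q)%N /\ (q %| m i)%N.
Proof.
move=> dP Pm; have [->|mi] := posnP (m i); first by left.
apply: (expchar_dvd Kq); have := mcoeff_mderiv i P (m - U_(i))%MM.
have -> : (m - U_(i) + U_(i) = m)%MM.
  by rewrite submK //; apply/mnm_lepP => j; rewrite mnm1E; case: eqP => // <-.
rewrite dP mcoeff0 mnmBE mnm1E eqxx subn1 prednK // => /esym/eqP.
by rewrite -[P@_m *+ _]mulr_natr mulf_eq0 mcoeff_eq0 Pm => /eqP.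
Qed.

Definition frob_exp n (e : 'I_n -> nat) (i : 'I_n) : nat := q ^ e i.

Lemma frob_exp_gt0 n (e : 'I_n -> nat) i : (0 < frob_exp e i)%N.
Proof. by rewrite expn_gt0 (expchar_gt0 Kq). Qed.

(** A vanishing partial means that all exponents of that variable are multiples of [q], so they can
    be divided by [q]. The monomial [m0] forces [1 < q] and makes the weight drop strictly. *)
Lemma mderiv_eq0_subst n (P : {mpoly K[n]}) (J : pred 'I_n) m0 i0 :
  (forall i, J i -> P^`M(i) = 0) -> m0 \in msupp P -> J i0 -> m0 i0 != 0%N ->
  exists2 Q, P = power_subst (frob_exp (fun i => J i : nat)) Q
           & (weight Q < weight P)%N.
Proof.
move=> dP Pm0 Ji0 m0i0.
have [q1 _] : (1 < q)%N /\ (q %| m0 i0)%N.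
  by case: (mderiv_eq0_dvd (dP _ Ji0) Pm0) => // e; rewrite e in m0i0.
pose phi (m : 'X_{1..n}) := [multinom m i %/ frob_exp (fun i => J i : nat) i | i < n].
have le_phi m i : (phi m i <= m i)%N by rewrite mnmE leq_div.
exists (\sum_(m <- msupp P) P@_m *: 'X_[phi m]); last first.
  apply: (weight_lt _ _ Pm0).
    by move=> m; rewrite !mdegE leq_sum.
  rewrite !mdegE (bigD1 i0) //= [X in (_ < X)%N](bigD1 i0) //= -addSn.
  rewrite leq_add ?leq_sum //.
  by rewrite mnmE /frob_exp Ji0 expn1 ltn_Pdiv // lt0n.
rewrite /power_subst mmap_lin_sum [LHS]mpolyE; apply: eq_big_seq => m Pm.
rewrite -mul_mpolyC mpolyXE_id; congr (_ * _); apply: eq_bigr => i _.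
rewrite -exprM mnmE /frob_exp.
have [Ji|_] := boolP (J i); last by rewrite mul1n divn1.
rewrite expn1 mulnC divnK //.
by case: (mderiv_eq0_dvd (dP _ Ji) Pm) => [->|[]].
Qed.

Variables (L : fieldType) (iota : {rmorphism K -> L}).

Lemma alg_independent_frob n (x : 'I_n -> L) e :
  alg_independent iota x ->
  alg_independent iota (fun i => x i ^+ (q ^ e i)).
Proof.
move=> indep P Px; apply: (@power_subst_eq0 _ _ (frob_exp e)).
  exact: frob_exp_gt0.
by apply: indep; rewrite mmap_power_subst.
Qed.

(** Descent on the weight: if all partials are zero polynomials, [P] comes from a lighter relation
    between the [q]-th powers; a nonzero partial that vanishes at [y] is itself a lighter relation.
    A single exponent [N] for all [y j] later allows a whole determinant to be untwisted. *)
Lemma separable_relation n (P : {mpoly K[n]}) (y : 'I_n -> L) :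
  P != 0 -> mmap iota y P = 0 ->
  exists (N : nat) (R : {mpoly K[n]}) (i : 'I_n),
    mmap iota (fun j => y j ^+ (q ^ N)) R = 0 /\
    mmap iota (fun j => y j ^+ (q ^ N)) R^`M(i) != 0.
Proof.
have [k] := ubnP (weight P); elim: k P y => // k IH P y ltk P0 Py.
have [/existsP [i dPi]|] := boolP [exists i, P^`M(i) != 0]; last first.
  rewrite negb_exists => /forallP dP.
  have {}dP i : xpredT i -> P^`M(i) = 0 by move=> _; apply/eqP; rewrite -[_ == _]negbK.
  have [m Pm [i mi]] : exists2 m, m \in msupp P & exists i, m i != 0%N.
    have [/hasP [m Pm /existsP [i mi]]|/hasPn N] :=
      boolP (has (fun m : 'X_{1..n} => [exists i, m i != 0%N]) (msupp P)).
      by exists m => //; exists i.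
    have leP : (msize P <= 1)%N.
      rewrite msizeE; apply/bigmax_leqP_seq => m /N Nm _.
      rewrite ltnS leqn0 mdegE big1 // => i _; apply/eqP.
      by apply: contraNT Nm => mi; apply/existsP; exists i.
    move: Py P0; rewrite (msize1_polyC leP) mmapC => /eqP.
    by rewrite fmorph_eq0 => /eqP ->; rewrite mpolyC0 eqxx.
  have [Q eP ltQ] := mderiv_eq0_subst dP Pm isT mi.
  have [|||N [R [j [Ry dRy]]]] := IH Q (fun j => y j ^+ q).
  - by lia.
  - by apply: contraNneq P0 => Q0; rewrite eP Q0 /power_subst mmap0.
  - rewrite -Py eP mmap_power_subst; apply: eq_mmap => // j.
  exists N.+1, R, j.
  have E S : mmap iota (fun l => y l ^+ (q ^ N.+1)) S =
             mmap iota (fun l => (y l ^+ q) ^+ (q ^ N)) S.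
    by apply: eq_mmap => // l; rewrite -exprM expnS.
  by rewrite !E.
have [dy|dy] := eqVneq (mmap iota y P^`M(i)) 0; last first.
  by exists 0%N, P, i; rewrite expn0.
by apply: (IH P^`M(i)) => //; have := weight_mderiv dPi; lia.
Qed.

(** Exponents are adjusted one variable at a time, since every partial must survive. Independence of
    the remaining elements ensures that a variable with zero partial still occurs in [P], so that
    dividing its exponents by [q] lowers the weight. *)
Lemma circuit_relation n (P : {mpoly K[n.+1]}) (x : 'I_n.+1 -> L) :
  (forall i, alg_independent iota (fun j => x (lift i j))) ->
  P != 0 -> mmap iota x P = 0 ->
  exists (e : 'I_n.+1 -> nat) (R : {mpoly K[n.+1]}),
    mmap iota (fun j => x j ^+ (q ^ e j)) R = 0 /\
    forall i, mmap iota (fun j => x j ^+ (q ^ e j)) R^`M(i) != 0.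
Proof.
have [k] := ubnP (weight P); elim: k P x => // k IH P x ltk indep P0 Px.
have [/forallP dx|] := boolP [forall i, mmap iota x P^`M(i) != 0].
  by exists (fun=> 0%N), P.
rewrite negb_forall => /existsP [i]; rewrite negbK => /eqP dx.
have [dPi|dPi] := eqVneq P^`M(i) 0; last first.
  by apply: (IH P^`M(i)) => //; have := weight_mderiv dPi; lia.
have [m Pm mi] : exists2 m, m \in msupp P & m i != 0%N.
  have [/hasP [m]|/hasPn N] :=
    boolP (has (fun m : 'X_{1..n.+1} => m i != 0%N) (msupp P)).
    by exists m.
  case/eqP: P0; apply: (drop_variable (indep i)) Px => m /N.
  by rewrite negbK => /eqP.
have dP j : pred1 i j -> P^`M(j) = 0 by move/eqP ->.
have [Q eP ltQ] := mderiv_eq0_subst dP Pm (eqxx i) mi.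
pose d j : nat := (j == i).
have [||||e [R [Ry dRy]]] := IH Q (fun j => x j ^+ (q ^ d j)).
- by lia.
- move=> j; exact: (@alg_independent_frob _ _ (fun l => d (lift j l)) (indep j)).
- by apply: contraNneq P0 => Q0; rewrite eP Q0 /power_subst mmap0.
- by rewrite -Px eP mmap_power_subst; apply: eq_mmap.
exists (fun j => d j + e j)%N, R.
have E S : mmap iota (fun j => x j ^+ (q ^ (d j + e j))) S =
  mmap iota (fun j => (x j ^+ (q ^ d j)) ^+ (q ^ e j)) S.
  by apply: eq_mmap => // j; rewrite -exprM -expnD.
by split=> [|j]; rewrite E.
Qed.

End SeparableRelation.

(** * Gradients and the Jacobian criterion *)

Definition fcons (T : Type) n (y : T) (t : 'I_n -> T) (i : 'I_n.+1) : T :=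
  if unlift ord0 i is Some j then t j else y.

Lemma fcons0 (T : Type) n y (t : 'I_n -> T) : fcons y t ord0 = y.
Proof. by rewrite /fcons unlift_none. Qed.

Lemma fconsS (T : Type) n y (t : 'I_n -> T) j : fcons y t (lift ord0 j) = t j.
Proof. by rewrite /fcons liftK. Qed.

Section Jacobian.
Variables (K L : fieldType) (iota : {rmorphism K -> L}).

(* [y] is separable over the field generated by the [t i], and
   dy = \sum_i (v i) d(t i). *)
Definition gradient n (t : 'I_n -> L) (y : L) (v : 'I_n -> L) : Prop :=
  exists P : {mpoly K[n.+1]},
  [/\ mmap iota (fcons y t) P = 0, mmap iota (fcons y t) P^`M(ord0) != 0 &
      forall i, mmap iota (fcons y t) P^`M(lift ord0 i) =
        - v i * mmap iota (fcons y t) P^`M(ord0)].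

Definition constants_derivation (F : L -> Prop) (D : L -> L) : Prop :=
  [/\ is_subfield F, derivation F idfun D &
      forall a, F (iota a) /\ D (iota a) = 0].

Lemma derivation_chain F D n (x : 'I_n -> L) (P : {mpoly K[n]}) :
  constants_derivation F D -> (forall i, F (x i)) -> mmap iota x P = 0 ->
  \sum_i mmap iota x P^`M(i) * D (x i) = 0.
Proof.
move=> [sF der_D D0] Fx Px; have sF' := subfield_subring sF.
have [] := mmap_derivation sF' der_D (fun c => (D0 c).1) (fun c => (D0 c).2) Fx P.
by rewrite Px (derivation0 sF' der_D).
Qed.

(** Evaluation at [t] is injective on polynomials, so any formal derivation passes to the fractions
    in [t]. *)
Lemma independent_derivation n (t c : 'I_n -> L) :
  alg_independent iota t ->
  exists F D, constants_derivation F D /\ forall i, F (t i) /\ D (t i) = c i.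
Proof.
move=> indep; pose S (P : {mpoly K[n]}) := True.
have sS : subring S by [].
pose d (P : {mpoly K[n]}) := \sum_i mmap iota t P^`M(i) * c i.
have der_d : derivation S (mmap iota t) d.
  split=> P Q _ _; rewrite /d.
    rewrite -sumrB; apply: eq_bigr => i _.
    by rewrite mderivB rmorphB mulrBl.
  rewrite mulr_suml mulr_sumr -big_split; apply: eq_bigr => i _ /=.
  by rewrite mderivM rmorphD !rmorphM /=; ring.
have d_ker P : S P -> mmap iota t P = 0 -> d P = 0.
  by move=> _ /indep ->; rewrite /d big1 // => i _; rewrite mderiv0 mmap0 mul0r.
have [D [der_D DE]] := fraction_derivation sS der_d d_ker.
exists (fraction_of S (mmap iota t)), D; split.
  split=> // [|a]; first exact: fraction_of_subfield.
  have <- : mmap iota t a%:MP = iota a by exact: mmapC.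
  split; first by apply: mem_fraction_of.
  by rewrite [LHS]DE // /d big1 // => i _; rewrite mderivC mmap0 mul0r.
move=> i; have <- : mmap iota t 'X_i = t i by rewrite mmapX mmap1U.
split; first by apply: mem_fraction_of.
rewrite [LHS]DE // /d (bigD1 i) //= mderivX mnm1E eqxx scale1r.
have -> : (U_(i) - U_(i) = 0 :> 'X_{1..n})%MM by rewrite -{1}[U_(i)%MM]add0m addmK.
rewrite mpolyX0 rmorph1 mul1r big1 ?addr0 // => j ji.
by rewrite mderivX mnm1E eq_sym (negPf ji) scale0r mmap0 mul0r.
Qed.

(** Substituting the other [x j] leaves a polynomial in one variable whose derivative at [x i] is
    the [i]-th partial. *)
Lemma separable_specialization F n (x : 'I_n -> L) i (P : {mpoly K[n]}) :
  is_subfield F -> (forall a, F (iota a)) -> (forall j, j != i -> F (x j)) ->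
  mmap iota x P = 0 -> mmap iota x P^`M(i) != 0 ->
  exists f : {poly L}, [/\ poly_over F f, f.[x i] = 0 & f^`().[x i] != 0].
Proof.
move=> sF F_iota Fx Px dPx; have sF' := subfield_subring sF.
have sP := poly_over_subring sF.
have FC c : F c -> poly_over F c%:P.
  by move=> Fc k; rewrite coefC; case: eqP => // _; apply: subring0.
pose h : {rmorphism K -> {poly L}} := (polyC \o iota)%FUN.
pose v j := if j == i then 'X else (x j)%:P.
have ev Q : (mmap h v Q).[x i] = mmap iota x Q.
  rewrite -[LHS]/(horner_eval (x i) (mmap h v Q)) mmap_rmorph.
  apply: eq_mmap => [c|j] /=; rewrite /horner_eval ?hornerC // /v.
  by case: eqP => [->|_]; rewrite ?hornerC ?hornerX.
have Fv j : poly_over F (v j).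
  rewrite /v; case: eqP => [_|/eqP ji]; last exact/FC/Fx.
  by move=> k; rewrite coefX; case: eqP => _; [apply: subring1 | apply: subring0].
have [Ff df] : poly_over F (mmap h v P) /\ (mmap h v P)^`().[x i] =
    \sum_j horner_eval (x i) (mmap h v P^`M(j)) * (v j)^`().[x i].
  apply: (mmap_derivation sP (deriv_derivation F (x i))) => // c; first exact: FC.
  by rewrite /= derivC horner0.
exists (mmap h v P); split=> //; first by rewrite ev.
rewrite df (bigD1 i) //= big1 ?addr0 => [|j ji].
  by rewrite /v eqxx derivX hornerC mulr1 /horner_eval ev.
by rewrite /v (negPf ji) derivC horner0 mulr0.
Qed.

Lemma gradient_derivation F D n (t : 'I_n -> L) y v :
  constants_derivation F D -> (forall i, F (t i)) -> gradient t y v ->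
  exists F' D', [/\ constants_derivation F' D', forall x, F x -> F' x,
    forall x, F x -> D' x = D x, F' y & D' y = \sum_i v i * D (t i)].
Proof.
move=> [sF der_D D0] Ft [P [Py dPy dPt]]; have sF' := subfield_subring sF.
have [j ji|f] := separable_specialization sF (fun a => (D0 a).1) _ Py dPy.
  by rewrite /fcons; case: unliftP ji => [//|->]; rewrite eqxx.
rewrite fcons0 => -[Ff fy f'y].
have [F' [D' [sF1 der_D' FF' F'y D'E]]] := separable_extension sF der_D Ff fy f'y.
exists F', D'.
have cD' : constants_derivation F' D'.
  by split=> // a; have [Fa Da] := D0 a; rewrite D'E //; split=> //; apply: FF'.
split=> //; have F'x i : F' (fcons y t i).
  by rewrite /fcons; case: unliftP => // j _; apply: FF'.
have := derivation_chain cD' F'x Py.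
rewrite big_ord_recl fcons0 => /eqP; rewrite addr_eq0 => /eqP e.
apply: (mulfI dPy); rewrite e mulr_sumr -sumrN; apply: eq_bigr => i _.
by rewrite dPt fconsS D'E //; ring.
Qed.

(** The [y j] are adjoined successively, so that one derivation differentiates them all. The values
    on [t] are kept in the induction because every gradient refers to [t]. *)
Lemma gradients_derivation n m (t c : 'I_n -> L) (y : 'I_m -> L) V :
  alg_independent iota t -> (forall j, gradient t (y j) (V j)) ->
  exists F D, constants_derivation F D /\
    forall j, F (y j) /\ D (y j) = \sum_i V j i * c i.
Proof.
move=> indep grad_y.
suff: forall k, exists F D, [/\ constants_derivation F D,
    forall i, F (t i) /\ D (t i) = c i & forall j : 'I_m, (j < k)%N ->
    F (y j) /\ D (y j) = \sum_i V j i * c i].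
  by move=> /(_ m) [F [D [FD _ Fy]]]; exists F, D; split=> // j; apply: Fy.
elim=> [|k [F [D [FD Ft Fy]]]].
  by have [F [D [FD Ft]]] := independent_derivation c indep; exists F, D.
have [ltkm|] := ltnP k m; last first.
  move=> lemk; exists F, D; split=> // j _.
  by apply: Fy; exact: leq_trans (ltn_ord j) lemk.
have [F' [D' [FD' FF' D'E F'y D'y]]] :=
  gradient_derivation FD (fun i => (Ft i).1) (grad_y (Ordinal ltkm)).
exists F', D'; split=> //.
  by move=> i; have [Fti <-] := Ft i; rewrite D'E //; split=> //; apply: FF'.
move=> j; rewrite ltnS leq_eqVlt => /orP [/eqP jk|ltjk]; last first.
  by have [Fyj <-] := Fy j ltjk; rewrite D'E //; split=> //; apply: FF'.
have -> : j = Ordinal ltkm by exact: val_inj.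
by rewrite D'y; split=> //; apply: eq_bigr => i _; rewrite (Ft i).2.
Qed.

End Jacobian.

Section Frobenius.
Variables (K L : fieldType) (iota : {rmorphism K -> L}) (q : nat).
Variables (fK : {rmorphism K -> K}) (fL : {rmorphism L -> L}).
Hypotheses (fKE : forall a, fK a = a ^+ q) (fLE : forall x, fL x = x ^+ q).

Lemma mmap_frob n (x : 'I_n -> L) P :
  mmap iota (fun i => x i ^+ q) (map_mpoly fK P) = (mmap iota x P) ^+ q.
Proof.
rewrite -fLE mmap_rmorph /map_mpoly mmap_rmorph; apply: eq_mmap => [a|i] /=.
  by rewrite mmapC fKE fLE; exact: rmorphXn.
by rewrite mmapX mmap1U fLE.
Qed.

Lemma mderiv_map_mpoly n (P : {mpoly K[n]}) i :
  (map_mpoly fK P)^`M(i) = map_mpoly fK P^`M(i).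
Proof.
apply/mpolyP => m.
rewrite mcoeff_mderiv !mcoeff_map_mpoly mcoeff_mderiv; exact: (esym (rmorphMn fK _ _)).
Qed.

(** Frobenius acts on the whole relation, coefficients included. Since the coordinates are raised
    together with [y], the gradient is twisted rather than killed. *)
Lemma gradient_frob N n (t : 'I_n -> L) y v : gradient iota t y v ->
  gradient iota (fun i => t i ^+ (q ^ N)) (y ^+ (q ^ N)) (fun i => v i ^+ (q ^ N)).
Proof.
move=> grad; elim: N => [|N [P [Py dPy dPt]]]; first by rewrite expn0.
exists (map_mpoly fK P).
have E Q : mmap iota (fcons (y ^+ (q ^ N.+1)) (fun i => t i ^+ (q ^ N.+1)))
    (map_mpoly fK Q) =
  (mmap iota (fcons (y ^+ (q ^ N)) (fun i => t i ^+ (q ^ N))) Q) ^+ q.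
  rewrite -mmap_frob; apply: eq_mmap => // i; rewrite /fcons.
  by case: unliftP => [j|] _; rewrite -exprM expnSr.
rewrite !mderiv_map_mpoly !E Py; split=> [||i].
- by rewrite -fLE rmorph0.
- by rewrite expf_neq0.
- by rewrite mderiv_map_mpoly E dPt -fLE rmorphM rmorphN !fLE -exprM expnSr.
Qed.

Hypothesis Kq : expchar K q.

(** The partials of a separable relation between the [q ^ N]-th powers of the [y j] form a nonzero
    row annihilated by the twisted matrix [V']. The determinant of [V'] is an iterated Frobenius
    image of [\det V], and Frobenius is injective. *)
Lemma jacobian_criterion n (t y : 'I_n -> L) (V : 'M[L]_n) P :
  alg_independent iota t -> (forall j, gradient iota t (y j) (V j)) ->
  P != 0 -> mmap iota y P = 0 -> \det V = 0.
Proof.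
move=> indep grad P0 Py.
have [N [R [i [Ry dRy]]]] := separable_relation Kq P0 Py.
suff: \det (map_mx (fun x => x ^+ (q ^ N)) V) = 0.
  elim: {Ry dRy} N => [|N IH]; first by rewrite expn0 map_mx_id // => x; rewrite expr1.
  move=> detV; apply: IH; apply/eqP; rewrite -(fmorph_eq0 fL) -det_map_mx -map_mx_comp.
  apply/eqP; rewrite -[RHS]detV; congr (\det _); apply/matrixP => a b.
  by rewrite !mxE /= fLE -exprM expnSr.
set V' := map_mx _ V; apply/eqP/det0P.
pose r := \row_j mmap iota (fun j => y j ^+ (q ^ N)) R^`M(j).
exists r; first by apply: contraNneq dRy => /matrixP /(_ 0 i); rewrite !mxE => ->.
apply/rowP => k.
pose t' i := t i ^+ (q ^ N).
have indep' : alg_independent iota t' by exact: (@alg_independent_frob _ _ Kq _ _ _ _ (fun=> N) indep).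
have grad' j : gradient iota t' (y j ^+ (q ^ N)) (V' j).
  have := gradient_frob N (grad j); rewrite /V'; case=> S [Sy dSy dSt].
  by exists S; split=> // l; rewrite mxE.
(* A derivation dual to the [k]-th coordinate reads off the [k]-th column of [V']. *)
have [F [D [FD Fy]]] := gradients_derivation (fun l => (l == k)%:R) indep' grad'.
have := derivation_chain FD (fun j => (Fy j).1) Ry.
move=> chain; rewrite [LHS]mxE [RHS]mxE -[RHS]chain.
apply: eq_bigr => j _; rewrite [r _ _]mxE (Fy j).2; congr (_ * _).
rewrite (bigD1 k) //= eqxx mulr1 big1 ?addr0 // => l /negPf ->.
by rewrite mulr0.
Qed.

End Frobenius.

(** Packaging Frobenius with [q] lets zero and positive characteristic share the later arguments. *)
Lemma expchar_exists (K : fieldType) : exists q, expchar K q /\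
  forall (L : fieldType) (iota : {rmorphism K -> L}),
  exists (fK : {rmorphism K -> K}) (fL : {rmorphism L -> L}),
    (forall a, fK a = a ^+ q) /\ (forall x, fL x = x ^+ q).
Proof.
have [[p Kp]|K0] := classic (exists p, p \in [pchar K]).
  exists p; split; first split.
  - by apply: prime_gt0; apply: pcharf_prime Kp.
  - by move=> _; apply: pcharf0 Kp.
  - move=> k /eqP; rewrite -(dvdn_pcharf Kp) => ->; right.
    by rewrite prime_gt1 // (pcharf_prime Kp).
  move=> L iota; have Lp : p \in [pchar L] by rewrite (fmorph_pchar iota).
  by exists (pFrobenius_aut Kp), (pFrobenius_aut Lp).
exists 1%N; split; last by exists idfun, idfun.
split=> // k k0; left; apply/eqP; apply: contra_notT K0 => k_neq0.
have k_gt0 : (0 < k)%N by rewrite lt0n.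
have [p] := natf0_pchar k_gt0 (introT eqP k0); by exists p.
Qed.

(** * Transcendence degree *)

Section Degrees.
Variables (m : nat) (K : fieldType).
Implicit Types P Q : {mpoly K[m]}.

Definition deg_le P D := (msize P <= D.+1)%N.

Lemma deg_le1 D : deg_le 1 D.
Proof. by rewrite /deg_le msize1. Qed.

Lemma deg_le0 D : deg_le 0 D.
Proof. by rewrite /deg_le msize0. Qed.

Lemma deg_leM P Q D D' : deg_le P D -> deg_le Q D' -> deg_le (P * Q) (D + D').
Proof.
rewrite /deg_le; have [->|P0] := eqVneq P 0; first by rewrite mul0r msize0.
have [->|Q0] := eqVneq Q 0; first by rewrite mulr0 msize0.
rewrite msizeM //; move: (msize P) (msize Q) => sP sQ; lia.
Qed.

Lemma deg_leB P Q D : deg_le P D -> deg_le Q D -> deg_le (P - Q) D.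
Proof.
rewrite /deg_le => leP leQ; apply: leq_trans (msizeD_le _ _) _.
by rewrite geq_max leP msizeN.
Qed.

Lemma deg_leX P D k : deg_le P D -> deg_le (P ^+ k) (D * k).
Proof.
move=> leP; elim: k => [|k IH]; first by rewrite expr0 deg_le1.
by rewrite exprS mulnS deg_leM.
Qed.

Lemma deg_le_prod (I : finType) (F : I -> {mpoly K[m]}) D :
  (forall i, deg_le (F i) D) -> deg_le (\prod_i F i) (#|I| * D).
Proof.
move=> leF; rewrite cardE -big_enum; elim: (enum I) => [|i s IH].
  by rewrite big_nil deg_le1.
by rewrite big_cons /= mulSn deg_leM.
Qed.

Lemma card_bmultinom D : (#|{: 'X_{1..m < D.+1}}| <= D.+1 ^ m)%N.
Proof.
pose f (k : 'X_{1..m < D.+1}) := [ffun i : 'I_m => inord (val k i) : 'I_D.+1].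
rewrite -[X in (_ <= X ^ _)%N]card_ord -[m in (_ <= _ ^ m)%N]card_ord -card_ffun.
apply: (@leq_card _ _ f) => k1 k2 /ffunP e; apply/val_inj/mnmP => i.
have le (k : 'X_{1..m < D.+1}) : (val k i < D.+1)%N.
  apply: leq_ltn_trans (bmdeg k); rewrite mdegE (bigD1 i) //=; exact: leq_addr.
by have := congr1 (@nat_of_ord _) (e i); rewrite !ffunE !inordK.
Qed.

End Degrees.

Lemma linear_dependence (K : fieldType) (I J : finType) (c : I -> J -> K) :
  (#|J| < #|I|)%N ->
  exists2 l : I -> K, exists i, l i != 0 & forall j, \sum_i l i * c i j = 0.
Proof.
move=> ltJI.
pose M := \matrix_(i < #|I|, j < #|J|) c (enum_val i) (enum_val j).
have : kermx M != 0.
  by rewrite kermx_eq0 /row_free; move: (rank_leq_col M) ltJI; case: eqP => //; lia.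
case/rowV0Pn => v /sub_kermxP vM v0.
exists (fun i => v 0 (enum_rank i)).
  have [i vi] : exists i, v 0 i != 0 by apply/rV0Pn.
  by exists (enum_val i); rewrite enum_valK.
move=> j; have := congr1 (fun A : 'rV_#|J| => A 0 (enum_rank j)) vM.
rewrite [RHS]mxE mxE => e; rewrite -[RHS]e.
rewrite (reindex (enum_val : 'I_#|I| -> I)) /=.
  by apply: eq_bigr => i _; rewrite enum_valK [M _ _]mxE enum_rankK.
by exists enum_rank => i _; rewrite ?enum_valK ?enum_rankK.
Qed.

Section TranscendenceDegree.
Variables (K L : fieldType) (iota : {rmorphism K -> L}).

Section Growth.
Variables (m : nat) (b : 'I_m -> L).
Notation ev := (mmap iota b).

(** Multiplication by [y] shifts the coefficients, and one more factor [c d.+1] allows the term in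
    [y ^+ d.+1] to be rewritten by the equation. Each step costs only [e] in degree; the counting
    argument rests on this linear growth. *)
Lemma power_reduction (y : L) d e (c : nat -> {mpoly K[m]}) :
  (forall k, (k <= d.+1)%N -> deg_le (c k) e) ->
  \sum_(k < d.+2) ev (c k) * y ^+ k = 0 ->
  forall k, exists A : nat -> {mpoly K[m]}, (forall i, deg_le (A i) (e * k)) /\
    ev (c d.+1) ^+ k * y ^+ k = \sum_(i < d.+1) ev (A i) * y ^+ i.
Proof.
move=> le_c cy; elim=> [|k [A [leA Ak]]].
  exists (fun i => if i is 0%N then 1 else 0); split.
    by case=> [|i]; rewrite ?deg_le1 ?deg_le0.
  rewrite big_ord_recl big1 => [|i _]; last by rewrite /= mmap0 mul0r.
  by rewrite rmorph1 !expr0 addr0.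
exists (fun i => (if i is j.+1 then c d.+1 * A j else 0) -
  if (i <= d)%N then A d * c i else 0); split.
  move=> i; rewrite mulnS; apply: deg_leB.
    by case: i => [|j]; rewrite ?deg_le0 // deg_leM // le_c.
  by case: leqP => [lei|_]; rewrite ?deg_le0 // addnC deg_leM // le_c // leqW.
rewrite !exprSr mulrACA Ak mulr_suml.
have -> : \sum_(i < d.+1) ev (A i) * y ^+ i * (ev (c d.+1) * y) =
   \sum_(i < d) ev (c d.+1 * A i) * y ^+ i.+1 +
    ev (A d) * (ev (c d.+1) * y ^+ d.+1).
  rewrite big_ord_recr /=; congr (_ + _); last by rewrite exprS; ring.
  by apply: eq_bigr => i _; rewrite rmorphM exprS /=; ring.
have -> : ev (c d.+1) * y ^+ d.+1 = - \sum_(i < d.+1) ev (c i) * y ^+ i.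
  by apply/eqP; rewrite -addr_eq0 addrC -[X in _ == X]cy [X in _ == X]big_ord_recr.
under [RHS]eq_bigr => i _.
  rewrite (leq_ord i) rmorphB rmorphM mulrBl -mulrA; over.
rewrite sumrB mulrN mulr_sumr; congr (_ - _).
by rewrite [RHS]big_ord_recl /= rmorph0 mul0r add0r.
Qed.

Lemma power_reduction_le (y : L) d e (c : nat -> {mpoly K[m]}) N D k :
  (forall k, (k <= d.+1)%N -> deg_le (c k) e) ->
  \sum_(k < d.+2) ev (c k) * y ^+ k = 0 -> (d < D)%N -> (k <= N)%N ->
  exists A : nat -> {mpoly K[m]}, (forall i, deg_le (A i) (e * N)) /\
    ev (c d.+1) ^+ N * y ^+ k = \sum_(i < D) ev (A i) * y ^+ i.
Proof.
move=> le_c cy ltdD lekN; have [A [leA Ak]] := power_reduction le_c cy k.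
exists (fun i => if (i < d.+1)%N then c d.+1 ^+ (N - k) * A i else 0); split.
  move=> i; case: ltnP => _; last exact: deg_le0.
  by rewrite -(subnK lekN) mulnDr addnK deg_leM // deg_leX // le_c.
rewrite -{1}(subnK lekN) exprD -mulrA Ak mulr_sumr.
rewrite (big_ord_widen D (fun i => ev (c d.+1) ^+ (N - k) * (ev (A i) * y ^+ i))) //.
rewrite big_mkcond; apply: eq_bigr => i _ /=.
by case: ltnP => _; rewrite ?rmorph0 ?mul0r // rmorphM rmorphXn mulrA.
Qed.

End Growth.
End TranscendenceDegree.

Section TranscendenceDegree.
Variables (K L : fieldType) (iota : {rmorphism K -> L}).

(* Counting: after multiplication by a common denominator, the (N+1)^n
   monomials of degree at most N in each [x j] lie in a space of dimension
   O(N^m). *)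
Lemma polynomially_dependent n m (b : 'I_m -> L) (x : 'I_n -> L)
    (d : 'I_n -> nat) (c : 'I_n -> nat -> {mpoly K[m]}) :
  (m < n)%N -> (forall j, mmap iota b (c j (d j).+1) != 0) ->
  (forall j, \sum_(k < (d j).+2) mmap iota b (c j k) * x j ^+ k = 0) ->
  exists2 P : {mpoly K[n]}, P != 0 & mmap iota x P = 0.
Proof.
move=> ltmn c0 cx.
pose D := (\max_j d j).+1.
have ltdD j : (d j < D)%N by rewrite ltnS leq_bigmax.
pose e := \max_j \max_(k < D.+1) msize (c j k).
have le_c j k : (k <= (d j).+1)%N -> deg_le (c j k) e.
  move=> lek; have ltk : (k < D.+1)%N by rewrite ltnS (leq_trans lek).
  apply: leq_trans (leqnSn _).
  apply: leq_trans (leq_bigmax (F := fun j => \max_(k < D.+1) msize (c j k)) j).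
  exact: (leq_bigmax (F := fun k : 'I_D.+1 => msize (c j k)) (Ordinal ltk)).
(* The target space has dimension at most [D ^ n * B.+1 ^ m]. As [B.+1 <= (n * e).+1 * N.+1], this
   is at most [N * N.+1 ^ m], which is less than the number [N.+1 ^ n] of monomials. *)
pose N := (D ^ n * (n * e).+1 ^ m)%N.
pose B := (n * (e * N))%N.
have ex_A j (k : 'I_N.+1) : exists A : nat -> {mpoly K[m]},
    (forall i, deg_le (A i) (e * N)) /\
    mmap iota b (c j (d j).+1) ^+ N * x j ^+ k =
    \sum_(i < D) mmap iota b (A i) * x j ^+ i.
  by apply: power_reduction_le => //; [exact: le_c | exact: leq_ord].
have [A hA] := fin_all_exists (fun j => fin_all_exists (ex_A j)).
pose s := \prod_j mmap iota b (c j (d j).+1) ^+ N.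
have s0 : s != 0 by apply/prodf_neq0 => j _; rewrite expf_neq0.
(* The coefficient of the reduced monomial with exponents [J] in [s] times the monomial with
   exponents [I]. The linear dependence below kills the coefficients of these polynomials for all
   [J] at once. *)
pose T (I : {ffun 'I_n -> 'I_N.+1}) (J : {ffun 'I_n -> 'I_D}) :=
  \prod_j A j (I j) (J j).
have leT I J : (msize (T I J) <= B.+1)%N.
  rewrite /B -[X in (X * _)%N]card_ord; apply: deg_le_prod => j.
  by case: (hA j (I j)).
have sx (I : {ffun 'I_n -> 'I_N.+1}) : s * \prod_j x j ^+ I j =
    \sum_(u : {ffun 'I_n -> 'I_D} * 'X_{1..m < B.+1})
      iota (T I u.1)@_(u.2) * (mmap1 b u.2 * \prod_j x j ^+ u.1 j).
  rewrite -big_split /=.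
  under eq_bigr => j _ do rewrite (hA j (I j)).2.
  rewrite bigA_distr_bigA /= -(pair_bigA _ (fun (J : {ffun 'I_n -> 'I_D}) (k : 'X_{1..m < B.+1}) =>
    iota (T I J)@_k * (mmap1 b k * \prod_j x j ^+ J j))) /=.
  apply: eq_bigr => J _; rewrite big_split /= -rmorph_prod -/(T I J).
  rewrite /= (mmapE _ (leT I J)) mulr_suml; apply: eq_bigr => k _.
  by rewrite mulrA.
have [|l [I0 lI0] lT] := @linear_dependence K {ffun 'I_n -> 'I_N.+1}
  ({ffun 'I_n -> 'I_D} * 'X_{1..m < B.+1})%type (fun I u => (T I u.1)@_(u.2)).
  rewrite card_prod !card_ffun !card_ord.
  apply: (@leq_ltn_trans (D ^ n * B.+1 ^ m)).
    by rewrite leq_mul2l card_bmultinom orbT.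
  apply: (@leq_ltn_trans (N * N.+1 ^ m)).
    rewrite /N -mulnA leq_mul2l -/N -expnMn; apply/orP; right.
    have [->|m_gt0] := posnP m; first by rewrite !expn0.
    by rewrite leq_exp2r // /B; nia.
  apply: (@leq_trans (N.+1 ^ m.+1)); first by rewrite expnS ltn_mul2r expn_gt0 ltnSn.
  by rewrite leq_pexp2l.
pose mon (I : {ffun 'I_n -> 'I_N.+1}) : 'X_{1..n} := [multinom (I j : nat) | j < n].
have mon_inj : injective mon.
  move=> I J e0; apply/ffunP => j; apply/val_inj.
  by have := (mnmP _ _).1 e0 j; rewrite !mnmE.
pose P : {mpoly K[n]} := \sum_I (l I)%:MP * 'X_[mon I].
exists P.
  apply: contraNneq lI0 => P0; apply/eqP.
  have <- : P@_(mon I0) = l I0; last by rewrite P0 mcoeff0.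
  rewrite raddf_sum (bigD1 I0) //= mcoeffCM mcoeffX eqxx mulr1 big1 ?addr0 // => I II0.
  by rewrite mcoeffCM mcoeffX (inj_eq mon_inj) (negPf II0) mulr0.
apply: (mulfI s0); rewrite mulr0 raddf_sum mulr_sumr /=.
transitivity (\sum_(u : {ffun 'I_n -> 'I_D} * 'X_{1..m < B.+1}) iota (\sum_I l I * (T I u.1)@_(u.2)) *
   (mmap1 b u.2 * \prod_j x j ^+ u.1 j)); last first.
  by rewrite big1 // => u _; rewrite lT rmorph0 mul0r.
under [RHS]eq_bigr => u _ do rewrite rmorph_sum mulr_suml.
rewrite exchange_big; apply: eq_bigr => I _ /=.
rewrite rmorphM /= mmapC mmapX mulrCA.
have -> : mmap1 x (mon I) = \prod_j x j ^+ I j.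
  by apply: eq_bigr => j _; rewrite mnmE.
rewrite sx mulr_sumr; apply: eq_bigr => u _.
by rewrite rmorphM mulrA.
Qed.

End TranscendenceDegree.

(** * Algebraic elements over a subfield *)

Section AlgebraicElements.
Variables (L : fieldType) (F : L -> Prop).
Hypothesis sF : is_subfield F.

(** Excluded middle makes [F] a boolean predicate and hence a field type, to which the closure of
    [algebraicOver] under field operations applies. *)
Definition subfield_pred : {pred L} := fun x =>
  if excluded_middle_informative (F x) then true else false.

Lemma subfield_predP x : reflect (F x) (x \in subfield_pred).
Proof.
by rewrite /in_mem /= /subfield_pred; case: excluded_middle_informative => h; constructor.
Qed.

Fact subfield_divring : divring_closed subfield_pred.
Proof.
split; first by apply/subfield_predP; apply: (subfield1 sF).
  move=> x y /subfield_predP Fx /subfield_predP Fy; apply/subfield_predP.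
  exact: (subfieldB sF).
move=> x y /subfield_predP Fx /subfield_predP Fy; apply/subfield_predP.
by apply: (subfieldM sF) => //; apply: (subfieldV sF).
Qed.

HB.instance Definition _ := GRing.isDivringClosed.Build L subfield_pred subfield_divring.

Record subfield_type : Type := SubfieldType {
  subfield_val : L; _ : subfield_val \in subfield_pred }.
HB.instance Definition _ := [isSub for subfield_val].
HB.instance Definition _ := [Choice of subfield_type by <:].
HB.instance Definition _ := [SubChoice_isSubIntegralDomain of subfield_type by <:].
HB.instance Definition _ := [SubIntegralDomain_isSubField of subfield_type by <:].

Lemma algebraic_overP x :
  algebraic_over F x <-> algebraicOver (val : {rmorphism subfield_type -> L}) x.
Proof.
split=> [[p [p0 Fp px]]|[p p0 px]]; last first.
  exists (map_poly val p); split=> // [|i]; first by rewrite map_poly_eq0.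
  by rewrite coef_map; apply/subfield_predP; apply: valP.
pose p' := \poly_(i < size p) insubd (0 : subfield_type) p`_i.
have ep : map_poly val p' = p.
  apply/polyP => i; rewrite coef_map coef_poly.
  case: ltnP => [_|lei]; last by rewrite nth_default // rmorph0.
  by rewrite /= insubdK //; apply/subfield_predP.
by exists p'; [apply: contraNneq p0 => e; rewrite -ep e rmorph0 | rewrite ep].
Qed.

Lemma algebraic_over_id x : F x -> algebraic_over F x.
Proof.
move=> /subfield_predP Fx; apply/algebraic_overP.
exact: (algebraic_id _ (SubfieldType Fx)).
Qed.

Lemma algebraic_over_subfield : is_subfield (algebraic_over F).
Proof.
split.
- by apply: algebraic_over_id; apply: subfield1.
- by move=> x y /algebraic_overP Ax /algebraic_overP Ay;
    apply/algebraic_overP; apply: algebraic_sub.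
- by move=> x y /algebraic_overP Ax /algebraic_overP Ay;
    apply/algebraic_overP; apply: algebraic_mul.
- by move=> x /algebraic_overP Ax; apply/algebraic_overP; apply: algebraic_inv.
Qed.

Lemma algebraic_over_root x k :
  (0 < k)%N -> algebraic_over F (x ^+ k) -> algebraic_over F x.
Proof.
move=> k0 [p [p0 Fp px]]; exists (p \Po 'X^k); split=> [|i|].
- by rewrite comp_poly_eq0 // size_polyXn ltnS.
- by rewrite coef_comp_poly_Xn //; case: ifP => // _; apply: (subring0 (subfield_subring sF)).
- by rewrite rootE horner_comp hornerXn.
Qed.

End AlgebraicElements.

Section TranscendenceDegree.
Variables (K L : fieldType) (iota : {rmorphism K -> L}).

Lemma adjoin_subfield S : is_subfield (adjoin iota S).
Proof.
split.
- by move=> P sP _ _; apply: subfield1.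
- by move=> x y Sx Sy P sP PK PS; apply: (subfieldB sP); [apply: Sx | apply: Sy].
- by move=> x y Sx Sy P sP PK PS; apply: (subfieldM sP); [apply: Sx | apply: Sy].
- by move=> x Sx P sP PK PS; apply: (subfieldV sP); apply: Sx.
Qed.

Lemma adjoin_const S a : adjoin iota S (iota a).
Proof. by move=> P _ PK _; apply: PK. Qed.

Lemma adjoin_gen (S : L -> Prop) x : S x -> adjoin iota S x.
Proof. by move=> Sx P _ _ PS; apply: PS. Qed.

Definition range_of n (b : 'I_n -> L) (y : L) : Prop := exists i, y = b i.

(** [adjoin] is an intersection of subfields, so it lies in the subfield of fractions of polynomials
    in [b]. *)
Lemma adjoin_fraction n (b : 'I_n -> L) x : adjoin iota (range_of b) x ->
  exists u w : {mpoly K[n]}, mmap iota b w != 0 /\ x = mmap iota b u / mmap iota b w.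
Proof.
pose S (P : {mpoly K[n]}) := True; have sS : subring S by [].
move=> /(_ _ (fraction_of_subfield (mmap iota b) sS)) [].
- move=> a; rewrite -(mmapC (n := n) b iota a).
  exact: (mem_fraction_of (mmap iota b) sS).
- move=> _ [i ->]; have <- : mmap iota b 'X_i = b i by rewrite mmapX mmap1U.
  exact: (mem_fraction_of (mmap iota b) sS).
- by move=> u [w [_ _ w0 ->]]; exists u, w.
Qed.

Lemma algebraic_polynomial n (b : 'I_n -> L) x :
  algebraic_over (adjoin iota (range_of b)) x ->
  exists (d : nat) (c : nat -> {mpoly K[n]}), mmap iota b (c d.+1) != 0 /\
    \sum_(k < d.+2) mmap iota b (c k) * x ^+ k = 0.
Proof.
move=> [p [p0 Fp px]].
have sp : (1 < size p)%N by apply: root_size_gt1 px.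
have [d sd] : exists d, size p = d.+2 by exists (size p).-2; lia.
have /fin_all_exists [u /fin_all_exists [w uw]] : forall k : 'I_d.+2,
    exists u w : {mpoly K[n]}, mmap iota b w != 0 /\ p`_k = mmap iota b u / mmap iota b w.
  by move=> k; apply: adjoin_fraction.
pose c (k : nat) : {mpoly K[n]} := u (inord k) * \prod_(j | j != inord k) w j.
have cE (k : 'I_d.+2) : mmap iota b (c k) = p`_k * \prod_j mmap iota b (w j).
  have [w0 ->] := uw k.
  rewrite rmorphM rmorph_prod inord_val [in RHS](bigD1 k) //= mulrA divfK //.
have w0 : \prod_j mmap iota b (w j) != 0.
  by apply/prodf_neq0 => j _; case: (uw j).
exists d, c; split.
  rewrite (cE ord_max) mulf_neq0 //=.
  by have : lead_coef p != 0; [rewrite lead_coef_eq0 | rewrite lead_coefE sd].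
under eq_bigr => k _ do rewrite cE mulrAC.
have := horner_coef p x; rewrite (rootP px) sd => e.
by rewrite -mulr_suml -e mul0r.
Qed.

Lemma algebraic_dependent n m (b : 'I_m -> L) (x : 'I_n -> L) :
  (m < n)%N -> (forall j, algebraic_over (adjoin iota (range_of b)) (x j)) ->
  exists2 P : {mpoly K[n]}, P != 0 & mmap iota x P = 0.
Proof.
move=> ltmn alg_x.
have /fin_all_exists [d /fin_all_exists [c dc]] := fun j => algebraic_polynomial (alg_x j).
apply: (polynomially_dependent (b := b) (d := d) (c := c)) => // j; by case: (dc j).
Qed.

(** If the [n] generators were dependent, one would be algebraic over the other [n - 1]. The [n]
    basis elements would then be algebraic over [n - 1] elements, hence dependent by
    [algebraic_dependent]. *)
Lemma trdeg_independent n (x : 'I_n -> L) q (S : L -> Prop) :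
  expchar K q -> trdeg_is iota (adjoin iota S) n ->
  (forall y, S y -> exists i, y = x i) ->
  alg_independent iota x.
Proof.
move=> Kq [b [indep_b Sb _]] Sx P Px; apply/eqP; apply/negP => /negP P0.
(* A nonzero partial keeps the relation nonzero after the other elements are substituted; [x i] is
   algebraic as soon as [x i ^+ (q ^ N)] is. *)
have [N [R [i [Ry dRy]]]] := separable_relation Kq P0 Px.
case: n => [|n] in x b i P R indep_b Sb Sx Px P0 Ry dRy *; first by case: i {dRy}.
pose F := adjoin iota (range_of (fun j => x (lift i j))).
have sF : is_subfield F by exact: adjoin_subfield.
have sAF := algebraic_over_subfield sF.
have Fx j : j != i -> F (x j).
  move=> ji; apply: adjoin_gen; case: (unliftP i j) ji => [k ->|->].
    by exists k.
  by rewrite eqxx.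
have qN : (0 < q ^ N)%N by rewrite expn_gt0 (expchar_gt0 Kq).
have [j ji|f [Ff fx f'x]] := separable_specialization sF (@adjoin_const _) _ Ry dRy.
  by apply: (subringX (subfield_subring sF)); apply: Fx.
have Axi : algebraic_over F (x i).
  apply: (algebraic_over_root sF qN); exists f; split=> //; last exact/rootP.
  by apply: contraNneq f'x => ->; rewrite deriv0 horner0.
have Ax j : algebraic_over F (x j).
  by have [->//|ji] := eqVneq j i; apply: algebraic_over_id => //; apply: Fx.
have [|Q Q0 Qb] := @algebraic_dependent n.+1 n (fun j => x (lift i j)) b (ltnSn n).
  move=> j; apply: (Sb j) => // [a|y /Sx [k ->]]; last exact: Ax.
  by apply: algebraic_over_id => //; apply: adjoin_const.
by rewrite (indep_b _ Qb) eqxx in Q0.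
Qed.

End TranscendenceDegree.

(** * Algebraic representations *)

Section GradientSubst.
Variables (K L : fieldType) (iota : {rmorphism K -> L}).

Lemma mmap_mderiv_derivation n (x : 'I_n -> L) j :
  derivation (fun=> True) (mmap iota x) (fun Q => mmap iota x Q^`M(j)).
Proof.
split=> P Q _ _; first by rewrite mderivB rmorphB.
by rewrite mderivM rmorphD !rmorphM.
Qed.

Lemma mmap_mderivU n (x : 'I_n -> L) a j :
  mmap iota x ('X_a)^`M(j) = (a == j)%:R.
Proof.
rewrite mderivX mnm1E; case: eqP => [->|_]; last by rewrite scale0r mmap0.
have -> : (U_(j) - U_(j) = 0 :> 'X_{1..n})%MM by rewrite -{1}[U_(j)%MM]add0m addmK.
by rewrite scale1r mpolyX0 rmorph1.
Qed.

(** The factor [(c l)%:R] is the point of this chain rule: for [c l = q ^ d] it is 1 if [d = 0], and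
    it is 0 if [0 < d] and [1 < q]. *)
Lemma gradient_subst n r (t : 'I_n -> L) y (k : 'I_r -> 'I_n) (c : 'I_r -> nat)
    (R : {mpoly K[r.+1]}) (p := fcons y (fun l => t (k l) ^+ c l)) :
  mmap iota p R = 0 -> mmap iota p R^`M(ord0) != 0 ->
  gradient iota t y (fun j => - (\sum_(l | k l == j)
    mmap iota p R^`M(lift ord0 l) * ((c l)%:R * t j ^+ (c l).-1)) /
    mmap iota p R^`M(ord0)).
Proof.
move=> Rp dRp.
pose u l' : {mpoly K[n.+1]} :=
  if unlift ord0 l' is Some l then 'X_(lift ord0 (k l)) ^+ c l else 'X_ord0.
have evX j : mmap iota (fcons y t) 'X_j = fcons y t j by rewrite mmapX mmap1U.
have ev Q : mmap iota (fcons y t) (mmap (@mpolyC _ K) u Q) = mmap iota p Q.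
  rewrite mmap_rmorph; apply: eq_mmap => [a|l'] /=; first exact: mmapC.
  rewrite /u /p {2}/fcons; case: unliftP => [l _|_].
    by rewrite rmorphXn /= evX fconsS.
  by rewrite evX fcons0.
have sT : subring (fun _ : {mpoly K[n.+1]} => True) by [].
have dP j : mmap iota (fcons y t) (mmap (@mpolyC _ K) u R)^`M(j) =
    \sum_l mmap iota p R^`M(l) * mmap iota (fcons y t) (u l)^`M(j).
  have [//|a|//|_ ->] := mmap_derivation sT (mmap_mderiv_derivation (fcons y t) j)
    (h := @mpolyC _ K) (v := u) _ _ _ R.
    by rewrite mderivC mmap0.
  by apply: eq_bigr => l _; rewrite /= ev.
have du j l : mmap iota (fcons y t) (u (lift ord0 l))^`M(j) =
    (c l)%:R * t (k l) ^+ (c l).-1 * (lift ord0 (k l) == j)%:R.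
  rewrite /u liftK (derivationX sT (mmap_mderiv_derivation (fcons y t) j)) //=.
  by rewrite evX fconsS mmap_mderivU.
have u0 : u ord0 = 'X_ord0 by rewrite /u unlift_none.
have dP0 : mmap iota (fcons y t) (mmap (@mpolyC _ K) u R)^`M(ord0) =
    mmap iota p R^`M(ord0).
  rewrite dP big_ord_recl u0 mmap_mderivU mulr1 big1 ?addr0 // => l _.
  by rewrite du mulr0 mulr0.
exists (mmap (@mpolyC _ K) u R); rewrite dP0 ev; split=> // j.
rewrite dP mulNr divfK // opprK big_ord_recl u0 mmap_mderivU mulr0 add0r.
rewrite [RHS]big_mkcond; apply: eq_bigr => l _ /=.
rewrite du (inj_eq lift_inj); case: eqP => [->|_]; last by rewrite !mulr0.
by rewrite mulr1.
Qed.

End GradientSubst.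

Section Representation.
Variables (K L : fieldType) (iota : {rmorphism K -> L}) (q : nat).
Hypothesis Kq : expchar K q.
Variables (E : finType) (M : matroid E) (f : E -> L).
Hypothesis rep : algebraic_representation iota M f.

Definition image_of (X : {set E}) (y : L) : Prop := exists2 e, e \in X & y = f e.

Lemma representation_independent n (e : 'I_n -> E) :
  (n <= M [set e i | i in 'I_n])%N -> alg_independent iota (fun i => f (e i)).
Proof.
move=> le_n; have := rep [set e i | i in 'I_n].
have -> : M [set e i | i in 'I_n] = n.
  apply/eqP; rewrite eqn_leq le_n andbT (leq_trans (rk_card _ _)) //.
  by rewrite (leq_trans (leq_imset_card _ _)) // card_ord.
move=> tr; apply: (trdeg_independent Kq tr) => y [_ /imsetP [i _ ->] ->].
by exists i.
Qed.

Lemma representation_dependent n (X : {set E}) (y : 'I_n -> L) :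
  (M X < n)%N -> (forall j, adjoin iota (image_of X) (y j)) ->
  exists2 P : {mpoly K[n]}, P != 0 & mmap iota y P = 0.
Proof.
move=> ltn Xy; have [b [_ _ alg_b]] := rep X.
by apply: (algebraic_dependent (b := b) ltn) => j; apply: alg_b.
Qed.

Lemma adjoin_power (X : {set E}) e k : e \in X -> adjoin iota (image_of X) (f e ^+ k).
Proof.
move=> eX; apply: (subringX (subfield_subring (adjoin_subfield _ _))).
by apply: adjoin_gen; exists e.
Qed.

Lemma representation_circuit n (e : 'I_n.+1 -> E) :
  (M [set e i | i in 'I_n.+1] <= n)%N ->
  (forall i, n <= M [set e (lift i j) | j in 'I_n])%N ->
  exists (a : 'I_n.+1 -> nat) (R : {mpoly K[n.+1]}),
    mmap iota (fun j => f (e j) ^+ (q ^ a j)) R = 0 /\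
    forall i, mmap iota (fun j => f (e j) ^+ (q ^ a j)) R^`M(i) != 0.
Proof.
move=> dep indep.
have [|P P0 Pe] := @representation_dependent _ _ (fun i => f (e i)) dep.
  by move=> j; rewrite -[f _]expr1; apply: adjoin_power; apply: imset_f.
apply: (circuit_relation Kq _ P0 Pe) => i.
exact: (representation_independent (indep i)).
Qed.

End Representation.

(** * The matroid *)

Section Ranks.
Variables (F : finFieldType) (F49 : #|F| = 49%N) (z : F) (z4 : 4.-primitive_root z).
Notation M := (QNF3_Q8 F49 z4).
Notation A := (Astar z).

Definition spans (X : {set ground}) (e : ground) : Prop :=
  ((A e)^T <= \sum_(f in X) <<(A f)^T>>)%MS.

Lemma spans_mem (X : {set ground}) e : e \in X -> spans X e.
Proof. by move=> eX; apply: (sumsmx_sup e) => //; rewrite genmxE. Qed.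

Lemma spans_comb (X : {set ground}) e f g (C D : 'M[F]_2) : A e = A f *m C + A g *m D ->
  spans X f -> spans X g -> spans X e.
Proof.
rewrite /spans => -> Xf Xg; rewrite linearD /= !trmx_mul addmx_sub //.
  exact: submx_trans (submxMl _ _) Xf.
exact: submx_trans (submxMl _ _) Xg.
Qed.

Lemma rank_spans (X Y : {set ground}) : (forall e, e \in Y -> spans X e) -> (M Y <= M X)%N.
Proof.
move=> XY; rewrite /= leq_div2r // !block_rankE; apply: mxrankS.
by apply/sumsmx_subP => e eY; rewrite genmxE; apply: XY.
Qed.

Lemma rank_points : (2 < M [set Pt i | i in 'I_3])%N.
Proof.
rewrite /= block_rankE; set S := (\sum_(e in _) _)%MS.
suff -> : \rank S = 6%N by [].
have [e0 e1 e2] := vblk_baseE z.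
have SP i : ((A (Pt i))^T <= S)%MS.
  by apply: (sumsmx_sup (Pt i)); rewrite ?genmxE // imset_f.
apply: (@sp_full _ z).
- by rewrite e0; apply: (SP ord0).
- by rewrite e1; apply: (SP (Ordinal (isT : (1 < 3)%N))).
- by rewrite e2; apply: (SP ord_max).
Qed.

Definition minus1 : Q8 := (true, qe).

Let z2 : z ^+ 2 = -1. Proof. by rewrite expr2; apply: prim4_sqr. Qed.

Lemma rho1 : rho z 1%g = 1%:M.
Proof.
by apply/matrixP => -[[|[|i]] Hi] // [[|[|j]] Hj] //; rewrite !mxE /= ?mulr1 ?mulr0.
Qed.

Lemma rho_minus1 : rho z minus1 = - 1%:M.
Proof.
apply/matrixP => -[[|[|i]] Hi] // [[|[|j]] Hj] //;
  by rewrite !mxE /= ?mulr1 ?mulr0 ?oppr0.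
Qed.

Lemma rhoV g : rho z g *m rho z g^-1%g = 1%:M.
Proof. by rewrite -rhoM // mulgV rho1. Qed.

(** The cyclic successor [ordS] makes the three families of blocks instances of one formula. *)
Lemma Astar_El g i :
  A (El g i) = A (Pt i) *m (- 1%:M) + A (Pt (ordS i)) *m rho z g.
Proof.
by case: i => [[|[|[|i]]] Hi] //=;
  rewrite -!stackM -!stackD !mul0mx !mul1mx ?addr0 ?add0r.
Qed.

Lemma Astar_OO i :
  A OO = A (Pt (ordS (ordS i))) *m 1%:M + A (El minus1 i) *m (- 1%:M).
Proof.
rewrite Astar_El rho_minus1 mulmxDl -!mulmxA.
by case: i => [[|[|[|i]]] Hi] //=;
  rewrite -!stackM -!stackD !mul0mx !mul1mx !mulmxN !mulNmx !mul1mx !opprK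
     ?addr0 ?add0r.
Qed.

Lemma spans_El X g i : spans X (Pt i) -> spans X (Pt (ordS i)) -> spans X (El g i).
Proof. exact: spans_comb (Astar_El g i). Qed.

Lemma spans_PtS X g i : spans X (El g i) -> spans X (Pt i) -> spans X (Pt (ordS i)).
Proof.
apply: (spans_comb (C := rho z g^-1%g) (D := rho z g^-1%g)).
rewrite Astar_El mulmxDl -!mulmxA rhoV mulmx1 mulNmx mul1mx mulmxN.
by rewrite addrAC addNr add0r.
Qed.

Lemma spans_Pt X g i : spans X (El g i) -> spans X (Pt (ordS i)) -> spans X (Pt i).
Proof.
apply: (spans_comb (C := - 1%:M) (D := rho z g)).
by rewrite Astar_El !mulmxN !mulmx1 opprD opprK addrNK.
Qed.

Lemma spans_OO X i :
  spans X (Pt (ordS (ordS i))) -> spans X (El minus1 i) -> spans X OO.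
Proof. exact: spans_comb (Astar_OO i). Qed.

Lemma spans_OO_Pt X i :
  spans X OO -> spans X (El minus1 i) -> spans X (Pt (ordS (ordS i))).
Proof.
apply: (spans_comb (C := 1%:M) (D := 1%:M)).
by rewrite (Astar_OO i) !mulmx1 mulmxN mulmx1 addrNK.
Qed.

Lemma spans_OO_El X i :
  spans X OO -> spans X (Pt (ordS (ordS i))) -> spans X (El minus1 i).
Proof.
apply: (spans_comb (C := - 1%:M) (D := 1%:M)).
by rewrite (Astar_OO i) !mulmx1 !mulmxN !mulmx1 opprD opprK addrAC addNr add0r.
Qed.

Lemma spans_triangle X g h k : (h * g * k = 1)%g ->
  spans X (El g ord0) -> spans X (El h (ordS ord0)) ->
  spans X (El k (ordS (ordS ord0))).
Proof.
(* These coefficients cancel [Pt (ordS ord0)] and leave the third point with coefficient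
   [- rho z (h * g * k)]; this dictates the order of the product. *)
move=> hgk; apply: (spans_comb (C := - rho z k) (D := - (rho z g *m rho z k))).
have S3 : ordS (ordS (ordS ord0)) = ord0 :> 'I_3 by exact: val_inj.
rewrite !Astar_El S3 !mulmxDl -!mulmxA !mulmxN !mulNmx !mul1mx !mulmxN !mulmx1 !opprK.
have -> : A (Pt (ordS (ordS ord0))) *m (rho z h *m (rho z g *m rho z k)) = A (Pt (ordS (ordS ord0))).
  by rewrite -!rhoM // mulgA hgk rho1 mulmx1.
by rewrite !addrA addrNK addrC.
Qed.

(** * Ranks of the circuits and lines *)

Lemma ordS3 (i : 'I_3) : ordS (ordS (ordS i)) = i.
Proof. by case: i => [[|[|[|i]]] Hi] //; apply: val_inj. Qed.

Lemma ord3P (i j : 'I_3) : [\/ j = i, j = ordS i | j = ordS (ordS i)].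
Proof.
case: i j => [[|[|[|i]]] Hi] // [[|[|[|j]]] Hj] //;
  by [constructor 1; apply: val_inj | constructor 2; apply: val_inj
     | constructor 3; apply: val_inj].
Qed.

(** Submodularity: adding the third point, of rank at most 1, must reach rank 3. *)
Lemma rank_pair i : (1 < M [set Pt i; Pt (ordS i)])%N.
Proof.
have := rk_submod M [set Pt i; Pt (ordS i)] [set Pt (ordS (ordS i))].
have := rk_card M [set Pt (ordS (ordS i))]; rewrite cards1.
have le3 : (2 < M ([set Pt i; Pt (ordS i)] :|: [set Pt (ordS (ordS i))]))%N.
  apply: leq_trans rank_points (rank_spans _) => _ /imsetP [j _ ->].
  apply: spans_mem; rewrite !inE.
  by case: (ord3P i j) => ->; rewrite eqxx ?orbT.
move: le3; move: (M _) (M _) (M _) (M _) => a b c d; lia.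
Qed.

(** The element to be differentiated comes first, as [ord0] does in [gradient]. *)
Definition segment g i : 'I_3 -> ground :=
  fcons (El g i) (fun l : 'I_2 => if l == ord0 then Pt i else Pt (ordS i)).

Definition frame : 'I_4 -> ground := fcons OO (fun i => Pt i).

Lemma mem_image_lift n (e : 'I_n.+1 -> ground) j k :
  k != j -> e k \in [set e (lift j l) | l in 'I_n].
Proof.
by case: (unliftP j k) => [l ->|->]; rewrite ?eqxx // => _; apply: imset_f.
Qed.

Lemma segment0 g i : segment g i ord0 = El g i.
Proof. exact: fcons0. Qed.

Lemma segment1 g i : segment g i (lift ord0 ord0) = Pt i.
Proof. by rewrite /segment fconsS. Qed.

Lemma segment2 g i : segment g i (lift ord0 ord_max) = Pt (ordS i).
Proof. by rewrite /segment fconsS. Qed.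

Lemma rank_segment g i : (M [set segment g i l | l in 'I_3] <= 2)%N.
Proof.
have card2 : (M [set Pt i; Pt (ordS i)] <= 2)%N.
  by apply: leq_trans (rk_card _ _) _; rewrite cards2; case: (_ != _).
apply: leq_trans (rank_spans _) card2 => _ /imsetP [l _ ->].
have s1 : spans [set Pt i; Pt (ordS i)] (Pt i) by apply: spans_mem; rewrite !inE eqxx.
have s2 : spans [set Pt i; Pt (ordS i)] (Pt (ordS i)).
  by apply: spans_mem; rewrite !inE eqxx orbT.
rewrite /segment /fcons; case: unliftP => [k _|_]; last exact: spans_El.
by case: (k == ord0).
Qed.

Lemma rank_segment_lift g i j : (1 < M [set segment g i (lift j l) | l in 'I_2])%N.
Proof.
set X := [set _ | _ in _].
have XE k : k != j -> spans X (segment g i k).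
  by move=> kj; apply: spans_mem; apply: mem_image_lift.
suff [s1 s2] : spans X (Pt i) /\ spans X (Pt (ordS i)).
  by apply: leq_trans (rank_pair i) (rank_spans _) => e; rewrite !inE => /orP [] /eqP ->.
have : [|| j == ord0, j == lift ord0 ord0 | j == lift ord0 ord_max].
  by case: j {X XE} => [[|[|[|j]]] Hj].
case/or3P => /eqP ej.
- have := XE (lift ord0 ord0); have := XE (lift ord0 ord_max).
  by rewrite segment1 segment2 ej => s2 s1; split; [apply: s1 | apply: s2].
- have := XE ord0; have := XE (lift ord0 ord_max).
  rewrite segment0 segment2 ej => /(_ isT) s2 /(_ isT) s0; split=> //.
  exact: spans_Pt s0 s2.
- have := XE ord0; have := XE (lift ord0 ord0).
  rewrite segment0 segment1 ej => /(_ isT) s1 /(_ isT) s0; split=> //.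
  exact: spans_PtS s0 s1.
Qed.

Lemma rank_frame : (M [set frame l | l in 'I_4] <= 3)%N.
Proof.
have card3 : (M [set Pt i | i in 'I_3] <= 3)%N.
  apply: leq_trans (rk_card _ _) _; apply: leq_trans (leq_imset_card _ _) _.
  by rewrite card_ord.
apply: leq_trans (rank_spans _) card3 => _ /imsetP [l _ ->].
have sP i : spans [set Pt i | i in 'I_3] (Pt i) by apply: spans_mem; apply: imset_f.
rewrite /frame /fcons; case: unliftP => [k _|_] //.
by apply: (spans_OO (i := ord0)) => //; apply: spans_El.
Qed.

Lemma rank_frame_lift j : (2 < M [set frame (lift j l) | l in 'I_3])%N.
Proof.
set X := [set _ | _ in _].
have XE k : k != j -> spans X (frame k).
  by move=> kj; apply: spans_mem; apply: mem_image_lift.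
apply: leq_trans rank_points (rank_spans _) => _ /imsetP [k _ ->].
have XP i : lift ord0 i != j -> spans X (Pt i).
  by move=> /XE; rewrite /frame fconsS.
have [ej|ne] := eqVneq (lift ord0 k) j; last exact: XP.
rewrite -(ordS3 k); apply: spans_OO_Pt.
  by have := XE ord0; rewrite /frame fcons0; apply; rewrite -ej.
have neS (i : 'I_3) : ordS i != i by case: i => [[|[|[|i]]] Hi].
have neSS (i : 'I_3) : ordS (ordS i) != i by case: i => [[|[|[|i]]] Hi].
by apply: spans_El; apply: XP; rewrite -ej (inj_eq lift_inj).
Qed.

Lemma rank_triangle g h k : (h * g * k = 1)%g ->
  (M [set El g ord0; El h (ordS ord0); El k (ordS (ordS ord0))] < 3)%N.
Proof.
move=> hgk; pose Y := [set El g ord0; El h (ordS ord0)].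
have cardY : (M Y <= 2)%N.
  by apply: leq_trans (rk_card _ _) _; rewrite cards2; case: (_ != _).
rewrite ltnS; apply: leq_trans (rank_spans _) cardY => e; rewrite !inE.
have s1 : spans Y (El g ord0) by apply: spans_mem; rewrite !inE eqxx.
have s2 : spans Y (El h (ordS ord0)) by apply: spans_mem; rewrite !inE eqxx orbT.
by move=> /orP [/orP []|] /eqP -> //; apply: spans_triangle hgk _ _.
Qed.

Lemma rank_minus1 i :
  (M [set Pt (ordS (ordS i)); OO; El minus1 i] < 3)%N.
Proof.
pose Y := [set Pt (ordS (ordS i)); OO].
have cardY : (M Y <= 2)%N.
  by apply: leq_trans (rk_card _ _) _; rewrite cards2; case: (_ != _).
rewrite ltnS; apply: leq_trans (rank_spans _) cardY => e; rewrite !inE.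
have s1 : spans Y (Pt (ordS (ordS i))) by apply: spans_mem; rewrite !inE eqxx.
have s2 : spans Y OO by apply: spans_mem; rewrite !inE eqxx orbT.
by move=> /orP [/orP []|] /eqP -> //; apply: spans_OO_El.
Qed.

End Ranks.

(** Rotating three columns is an even permutation, so one expansion serves for every starting column
    [i]. *)
Lemma det_mx33 (R : comNzRingType) (V : 'M[R]_3) (i : 'I_3) (j := ordS i) (k := ordS j)
    (a : 'I_3 := ord0) (b := ordS a) (c := ordS b) :
  \det V = V a i * (V b j * V c k - V b k * V c j)
         + V a j * (V b k * V c i - V b i * V c k)
         + V a k * (V b i * V c j - V b j * V c i).
Proof.
pose f (x y : nat) := V (inord x) (inord y).
have -> : \det V = (f 0%N 0%N * (f 1%N 1%N * f 2%N 2%N - f 1%N 2%N * f 2%N 1%N)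
         + f 0%N 1%N * (f 1%N 2%N * f 2%N 0%N - f 1%N 0%N * f 2%N 2%N)
         + f 0%N 2%N * (f 1%N 0%N * f 2%N 1%N - f 1%N 1%N * f 2%N 0%N))%R.
  rewrite (expand_det_row _ ord0) !big_ord_recl big_ord0 /cofactor.
  have e x y : V x y = f x y by rewrite /f !inord_val.
  rewrite !(expand_det_row _ ord0) !big_ord_recl !big_ord0 /cofactor !det_mx11 !mxE !e /=.
  rewrite !expr0 /bump /=; ring.
have e x y : V x y = f x y by rewrite /f !inord_val.
rewrite !e {}/k {}/j {}/c {}/b {}/a; case: i => [[|[|[|i]]] Hi] //=; ring.
Qed.

Section Gradients.
Variables (K L : fieldType) (iota : {rmorphism K -> L}).

Lemma eq_gradient n (t t' : 'I_n -> L) y v :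
  t =1 t' -> gradient iota t y v -> gradient iota t' y v.
Proof.
move=> et [P [Py dPy dPt]]; exists P.
have E Q : mmap iota (fcons y t') Q = mmap iota (fcons y t) Q.
  by apply: eq_mmap => // i; rewrite /fcons; case: unliftP.
by rewrite !E; split=> // i; rewrite E.
Qed.

Lemma gradient_coord n (t : 'I_n -> L) i :
  gradient iota t (t i) (fun j => (j == i)%:R).
Proof.
exists ('X_ord0 - 'X_(lift ord0 i)).
have dX j : mmap iota (fcons (t i) t) ('X_ord0 - 'X_(lift ord0 i))^`M(j) =
    (ord0 == j)%:R - (lift ord0 i == j)%:R.
  by rewrite mderivB rmorphB /= !mmap_mderivU.
rewrite !dX eqxx subr0 oner_neq0; split=> // [|j].
  by rewrite rmorphB /= !mmapX !mmap1U fcons0 fconsS subrr.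
by rewrite dX (inj_eq lift_inj) mulr1 sub0r eq_sym.
Qed.

Variables (q : nat) (fK : {rmorphism K -> K}) (fL : {rmorphism L -> L}).
Hypotheses (fKE : forall a, fK a = a ^+ q) (fLE : forall x, fL x = x ^+ q).

Lemma mmap_frob_iter N n (x : 'I_n -> L) P :
  mmap iota (fun i => x i ^+ (q ^ N)) (iter N (map_mpoly fK) P) =
  mmap iota x P ^+ (q ^ N).
Proof.
elim: N => [|N IH] /=; first by rewrite expn0.
rewrite expnSr exprM -IH -(mmap_frob iota fKE fLE).
by apply: eq_mmap => // i; rewrite exprM.
Qed.

Lemma mderiv_frob_iter N n (P : {mpoly K[n]}) i :
  (iter N (map_mpoly fK) P)^`M(i) = iter N (map_mpoly fK) P^`M(i).
Proof. by elim: N => //= N IH; rewrite mderiv_map_mpoly IH. Qed.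

End Gradients.

(** * The group Q8 *)

(** As -1 is central, exchanging it with [g] identifies [d] on the first two sides. Eliminating the
    third side gives [d ord0 g + d ord0 h = d ord0 (minus1 * (h * g))]. An element of order 4
    squares to -1, so twice its value is [d ord0 1 = 0]. *)
Lemma Q8_additive_trivial (d : 'I_3 -> Q8 -> int) :
  (forall g h k, (h * g * k = 1)%g ->
    d ord0 g + d (ordS ord0) h + d (ordS (ordS ord0)) k = 0) ->
  (forall i, d i minus1 = 0) -> forall i g, d i g = 0.
Proof.
move=> dM dm.
have d01 g : d (ordS ord0) g = d ord0 g.
  have e1 := dM g minus1 (minus1 * g)^-1%g (mulgV _).
  have := dM minus1 g (g * minus1)^-1%g (mulgV _).
  have -> : (g * minus1 = minus1 * g)%g by case: g {e1} => [[] []].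
  by move: e1; rewrite !dm; lia.
have d2 g : d (ordS (ordS ord0)) g = - d ord0 (minus1 * g^-1)%g.
  have := dM (minus1 * g^-1)%g minus1 g.
  rewrite dm; have -> : (minus1 * (minus1 * g^-1) * g = 1)%g by case: g => [[] []].
  by move=> /(_ erefl); lia.
have dD g h : d ord0 g + d ord0 h = d ord0 (minus1 * (h * g))%g.
  have := dM g h (h * g)^-1%g (mulgV _); rewrite d01 d2 invgK; lia.
have d1 : d ord0 1%g = 0.
  have := dD 1%g 1%g; have -> : (minus1 * (1 * 1) = minus1)%g by [].
  by rewrite dm; lia.
have d0 g : d ord0 g = 0.
  have [->|->|gg] // : [\/ g = 1, g = minus1 | minus1 * (g * g) = 1]%g.
    by case: g => [[] []]; by [constructor 1 | constructor 2 | constructor 3].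
  by have := dD g g; rewrite gg d1; lia.
move=> i g; case: (ord3P ord0 i) => ->; rewrite ?d2 ?d01 ?d0 //.
Qed.

(** Commutativity gives [k] and [k'] the same value on the third side. The triangles [(k, m, k)] and
    [(1, k, k')] then evaluate the product of [X ord0 k] with that value to -1 and to 1. *)
Lemma Q8_multiplicative_char2 (L : fieldType) (X : 'I_3 -> Q8 -> L) :
  (forall g h k, (h * g * k = 1)%g ->
    X ord0 g * X (ordS ord0) h * X (ordS (ordS ord0)) k = 1) ->
  (forall i, X i minus1 = -1) -> 2%N \in [pchar L].
Proof.
move=> XM Xm.
pose i : Q8 := (false, qi); pose j : Q8 := (false, qj); pose k : Q8 := (false, qk).
pose k' : Q8 := (true, qk); pose m := minus1.
have Xij := XM i j k erefl; have Xji := XM j i k' erefl.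
have X01 g : X (ordS ord0) g = X ord0 g.
  have := XM g m (m * g)^-1%g (mulgV _); rewrite Xm => e1.
  have := XM m g (g * m)^-1%g (mulgV _); rewrite Xm.
  have -> : (g * m = m * g)%g by case: g {e1} => [[] []].
  move=> e2; have X2 : X (ordS (ordS ord0)) (m * g)^-1%g != 0.
    by apply: contra_eq_neq e1 => ->; rewrite mulr0 eq_sym oner_neq0.
  apply: (mulfI (_ : -1 != 0)); first by rewrite oppr_eq0 oner_neq0.
  by apply: (mulIf X2); rewrite e2 -[LHS]e1; ring.
have Xkk : X (ordS (ordS ord0)) k = X (ordS (ordS ord0)) k'.
  have X0 : X ord0 i * X ord0 j != 0.
    apply: contra_eq_neq Xij => e; rewrite X01 e mul0r eq_sym oner_neq0 //.
  apply: (mulfI X0); move: Xij Xji; rewrite !X01 => -> <-; ring.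
have Xk := XM k m k erefl; have X1k := XM 1%g k k' erefl.
have X1 := XM 1%g m m erefl.
rewrite !Xm in X1 Xk; rewrite X01 -Xkk in X1k.
rewrite inE /=; apply/eqP.
have e1 : X ord0 1%g = 1 by rewrite -[RHS]X1; ring.
rewrite e1 mul1r in X1k; rewrite mulrN1 mulNr X1k in Xk.
by rewrite -[2%:R]/(1 + 1) -{1}Xk addNr.
Qed.

(** * The representation *)

Section Main.
Variables (F : finFieldType) (F49 : #|F| = 49%N) (z : F) (z4 : 4.-primitive_root z).
Notation M := (QNF3_Q8 F49 z4).
Variables (K L : fieldType) (iota : {rmorphism K -> L}) (q : nat).
Variables (fK : {rmorphism K -> K}) (fL : {rmorphism L -> L}).
Hypotheses (fKE : forall a, fK a = a ^+ q) (fLE : forall x, fL x = x ^+ q).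
Hypothesis Kq : expchar K q.
Variable f : ground -> L.
Hypothesis rep : algebraic_representation iota M f.

(** The exponents [s] stay a parameter because different relations are separable over different
    powers of the points. *)
Definition points (s : 'I_3 -> nat) (i : 'I_3) : L := f (Pt i) ^+ (q ^ s i).

Lemma points_independent s : alg_independent iota (points s).
Proof.
have := representation_independent Kq rep (rank_points F49 z4).
exact: (@alg_independent_frob _ _ Kq).
Qed.

Lemma frame_gradient : exists (a : 'I_3 -> nat) (a0 : nat) (o : 'I_3 -> L),
  (forall i, o i != 0) /\
  gradient iota (points a) (f OO ^+ (q ^ a0)) o.
Proof.
have [e [R [R0 dR]]] :=
  representation_circuit Kq rep (rank_frame F49 z4) (rank_frame_lift F49 z4).
pose a i := e (lift ord0 i); pose y := f OO ^+ (q ^ e ord0).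
pose p := fcons y (fun l => points a l ^+ 1).
have pE Q : mmap iota (fun j => f (frame j) ^+ (q ^ e j)) Q = mmap iota p Q.
  apply: eq_mmap => // j; rewrite /p /frame /fcons /y /points /a.
  by case: unliftP => [k ->|->]; rewrite ?expr1.
have Rp : mmap iota p R = 0 by rewrite -pE.
have dRp : mmap iota p R^`M(ord0) != 0 by rewrite -pE.
exists a, (e ord0); eexists; split; last first.
  exact: (gradient_subst (k := id) (c := fun=> 1%N) Rp dRp).
move=> i; rewrite mulf_neq0 ?invr_eq0 // oppr_eq0 big_pred1_eq expr0 !mulr1.
by rewrite -pE.
Qed.

(* In the relation between [El g i], [Pt i] and [Pt (ordS i)] that becomes
   separable after raising them to the powers q^w, q^u, q^v, raising a point to
   a smaller power instead kills its differential. *)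
Definition segment_exponents g i (e : nat * nat * nat) : Prop :=
  forall (N : nat) (s : 'I_3 -> nat),
  (s i <= e.1.2 + N)%N -> (s (ordS i) <= e.2 + N)%N ->
  exists r : 'I_3 -> L,
  [/\ gradient iota (points s) (f (El g i) ^+ (q ^ (e.1.1 + N))) r,
      r (ordS (ordS i)) = 0,
      (s i = e.1.2 + N)%N -> r i != 0,
      (s (ordS i) = e.2 + N)%N -> r (ordS i) != 0 &
      (1 < q)%N -> ((s i < e.1.2 + N)%N -> r i = 0) /\
                   ((s (ordS i) < e.2 + N)%N -> r (ordS i) = 0)].

Lemma segment_gradient g i : exists e, segment_exponents g i e.
Proof.
have [e [R [R0 dR]]] :=
  representation_circuit Kq rep (rank_segment F49 z4 g i) (rank_segment_lift F49 z4 g i).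
pose u := e (lift ord0 ord0); pose v := e (lift ord0 ord_max).
exists (e ord0, u, v) => N s /= leu lev.
pose k (l : 'I_2) := if l == ord0 then i else ordS i.
(* The gap between the level [s] of a coordinate and the level that the twisted relation [RN]
   demands; when [1 < q], a positive gap kills the corresponding coefficient. *)
pose d (l : 'I_2) := if l == ord0 then (u + N - s i)%N else (v + N - s (ordS i))%N.
pose y := f (El g i) ^+ (q ^ (e ord0 + N)).
pose p := fcons y (fun l => points s (k l) ^+ (q ^ d l)).
pose RN := iter N (map_mpoly fK) R.
have pE Q : mmap iota p (iter N (map_mpoly fK) Q) =
    mmap iota (fun j => f (segment g i j) ^+ (q ^ e j)) Q ^+ (q ^ N).
  rewrite -(mmap_frob_iter iota fKE fLE); apply: eq_mmap => // j.
  rewrite -exprM -expnD /p /segment /fcons /points.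
  case: unliftP => [l ->|-> //]; rewrite -exprM -expnD /k /d.
  have [->|ne] := eqVneq l ord0; first by rewrite subnKC.
  rewrite subnKC // /v; congr (_ ^+ (q ^ (e (lift ord0 _) + N))).
  by case: l ne => [[|[|l]] Hl] // _; apply: val_inj.
have qN : (0 < q ^ N)%N by rewrite expn_gt0 (expchar_gt0 Kq).
have Rp : mmap iota p RN = 0 by rewrite pE R0 expr0n eqn0Ngt qN.
have dRp j : mmap iota p RN^`M(j) != 0.
  by rewrite mderiv_frob_iter pE expf_neq0.
have grad := @gradient_subst _ _ iota 3 2 (points s) y k (fun l => q ^ d l)%N RN Rp (dRp ord0).
exists (fun j => - (\sum_(l | k l == j) mmap iota p RN^`M(lift ord0 l) *
   ((q ^ d l)%:R * points s j ^+ (q ^ d l).-1)) / mmap iota p RN^`M(ord0)).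
have neS : ordS i != i by case: (i) => [[|[|[|j]]] Hj].
have neSS : ordS (ordS i) != i by case: (i) => [[|[|[|j]]] Hj].
have neSS' : ordS (ordS i) != ordS i by case: (i) => [[|[|[|j]]] Hj].
have k0 j : (k j == i) = (j == ord0).
  by rewrite /k; case: (j == ord0); rewrite ?eqxx // (negPf neS).
have k1 j : (k j == ordS i) = (j == ord_max).
  rewrite /k; case: j => [[|[|j]] Hj] //=; rewrite ?eqxx //.
  by rewrite eq_sym (negPf neS).
have k2 j : (k j == ordS (ordS i)) = false.
  by rewrite /k; case: (j == ord0); rewrite eq_sym; apply: negbTE.
have q_char c : (1 < q)%N -> (0 < c)%N -> (q ^ c)%:R = 0 :> L.
  move=> q1 c0; rewrite -(rmorph_nat iota) natrX (expchar_eq0 Kq q1).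
  by rewrite expr0n eqn0Ngt c0 rmorph0.
rewrite !(eq_bigl _ _ k0) !(eq_bigl _ _ k1) !(eq_bigl _ _ k2) !big_pred1_eq big_pred0_eq.
split=> //.
- by rewrite oppr0 mul0r.
- move=> es; rewrite mulf_neq0 ?invr_eq0 // oppr_eq0 /d eqxx es subnn expn0.
  by rewrite expr0 !mulr1.
- move=> es; rewrite mulf_neq0 ?invr_eq0 // oppr_eq0 /d /= es subnn expn0.
  by rewrite expr0 !mulr1.
- move=> q1; split=> lt_s; rewrite q_char //.
  + by rewrite mul0r mulr0 oppr0 mul0r.
  + by rewrite /d eqxx subn_gt0.
  + by rewrite mul0r mulr0 oppr0 mul0r.
  + by rewrite /d /= subn_gt0.
Qed.

Lemma gradients_det s (X : {set ground}) y0 y1 y2 v0 v1 v2 i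
    (j := ordS i) (k := ordS j) : (M X < 3)%N ->
  adjoin iota (image_of f X) y0 -> adjoin iota (image_of f X) y1 ->
  adjoin iota (image_of f X) y2 ->
  gradient iota (points s) y0 v0 -> gradient iota (points s) y1 v1 ->
  gradient iota (points s) y2 v2 ->
  v0 i * (v1 j * v2 k - v1 k * v2 j) + v0 j * (v1 k * v2 i - v1 i * v2 k)
    + v0 k * (v1 i * v2 j - v1 j * v2 i) = 0.
Proof.
move=> ltX X0 X1 X2 g0 g1 g2.
pose rows (T : Type) (a b c : T) (l : 'I_3) :=
  match val l with 0 => a | 1 => b | _ => c end%N.
pose y := rows _ y0 y1 y2; pose V := \matrix_(a, b) rows _ v0 v1 v2 a b.
have [|P P0 Py] := representation_dependent rep (y := y) ltX.
  by case=> [[|[|[|l]]] Hl].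
have grad l : gradient iota (points s) (y l) (V l).
  have e : V l =1 rows _ v0 v1 v2 l by move=> b; rewrite mxE.
  have [Q [Qy dQ0 dQ]] : gradient iota (points s) (y l) (rows _ v0 v1 v2 l).
    by case: l {e} => [[|[|[|l]]] Hl].
  by exists Q; split=> // b; rewrite e.
have := jacobian_criterion fKE fLE Kq (@points_independent s) grad P0 Py.
by rewrite (det_mx33 V i) !mxE.
Qed.

(** The gradient of the remaining point is a unit vector, which reduces the determinant to the minor
    in the other two coordinates. *)
Lemma minus1_proportional s a0 w i o r :
  gradient iota (points s) (f OO ^+ (q ^ a0)) o ->
  gradient iota (points s) (f (El minus1 i) ^+ (q ^ w)) r ->
  r (ordS (ordS i)) = 0 -> o i * r (ordS i) = o (ordS i) * r i.
Proof.
move=> grad_o grad_r r0; set k := ordS (ordS i).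
have := gradients_det k (rank_minus1 F49 z4 i) _ _ _
  (gradient_coord iota (points s) k) grad_o grad_r.
rewrite /k r0 ordS3 eqxx.
have -> : (i == ordS (ordS i)) = false by case: (i) => [[|[|[|j]]] Hj].
have -> : (ordS i == ordS (ordS i)) = false by case: (i) => [[|[|[|j]]] Hj].
rewrite !mul0r !addr0 mul1r => H; apply/eqP; rewrite -subr_eq0; apply/eqP/H;
  by apply: adjoin_power; rewrite !inE eqxx ?orbT.
Qed.

(** With one zero in each row, only two of the six terms of the determinant survive, one for each
    way around the triangle. *)
Lemma triangle_relation s g h k w0 w1 w2 r0 r1 r2
    (a := ord0) (b := ordS a) (c := ordS b) : (h * g * k = 1)%g ->
  gradient iota (points s) (f (El g a) ^+ (q ^ w0)) r0 ->
  gradient iota (points s) (f (El h b) ^+ (q ^ w1)) r1 ->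
  gradient iota (points s) (f (El k c) ^+ (q ^ w2)) r2 ->
  r0 c = 0 -> r1 a = 0 -> r2 b = 0 ->
  r0 a * r1 b * r2 c + r0 b * r1 c * r2 a = 0.
Proof.
move=> hgk g0 g1 g2 r0c r1a r2b.
have := gradients_det a (rank_triangle F49 z4 hgk) _ _ _ g0 g1 g2.
rewrite -/b -/c r0c r1a r2b mulr0 subr0 !mul0r subr0 addr0 !mulrA; apply;
  by apply: adjoin_power; rewrite !inE eqxx ?orbT.
Qed.

Lemma representation_char2 : 2%N \in [pchar L].
Proof.
have [a [a0 [o [o0 grad_o]]]] := frame_gradient.
have [e he] := fin_all_exists (fun gi : Q8 * 'I_3 => segment_gradient gi.1 gi.2).
pose u g i := (e (g, i)).1.2; pose v g i := (e (g, i)).2.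
have grad_oN N : gradient iota (points (fun l => a l + N)%N)
    (f OO ^+ (q ^ (a0 + N))) (fun l => o l ^+ (q ^ N)).
  have := gradient_frob fKE fLE N grad_o; rewrite -exprM -expnD.
  by apply: eq_gradient => l; rewrite /points -exprM -expnD.
have oN N l : o l ^+ (q ^ N) != 0 by rewrite expf_neq0.
have uv_minus1 i : (1 < q)%N -> (u minus1 i + a (ordS i) = v minus1 i + a i)%N.
  (* Both level constraints hold as long as [N] is at most each of the two sums. At the minimum,
     unequal sums would kill exactly one of [r i] and [r (ordS i)], against proportionality to the
     nonzero entries of [o]. *)
  move=> q1; pose N := minn (u minus1 i + a (ordS i)) (v minus1 i + a i).
  have [||r [grad_r r2 r0 r1 /(_ q1) [r0' r1']]] :=
      he (minus1, i) (a i + a (ordS i))%N (fun l => a l + N)%N; rewrite -/(u _ _) -/(v _ _) /=.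
  - by rewrite /N; lia.
  - by rewrite /N; lia.
  have pr := minus1_proportional (grad_oN N) grad_r r2.
  have [lt|lt|//] := ltngtP (u minus1 i + a (ordS i)) (v minus1 i + a i).
    have ri : r i != 0 by apply: r0; rewrite -/(u _ _) /= /N; lia.
    have ri' : r (ordS i) = 0 by apply: r1'; rewrite -/(v _ _) /= /N; lia.
    move/eqP: pr; rewrite ri' mulr0 eq_sym mulf_eq0 (negPf ri) (negPf (oN _ _)).
    by [].
  have ri' : r (ordS i) != 0 by apply: r1; rewrite -/(v _ _) /= /N; lia.
  have ri : r i = 0 by apply: r0'; rewrite -/(u _ _) /= /N; lia.
  by move/eqP: pr; rewrite ri mulr0 mulf_eq0 (negPf ri') (negPf (oN _ _)).
have uv_triangle g h k : (1 < q)%N -> (h * g * k = 1)%g ->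
    (u g ord0 + u h (ordS ord0) + u k (ordS (ordS ord0)) =
     v g ord0 + v h (ordS ord0) + v k (ordS (ordS ord0)))%N.
  move=> q1 hgk.
  set ug := u g _; set uh := u h _; set uk := u k _.
  set vg := v g _; set vh := v h _; set vk := v k _.
  (* The shifts [uh + uk], [vg + uk] and [vg + vh] make adjacent sides demand equal powers of the
     second and third points. Of the first point they demand the two sums under comparison; at the
     smaller one, inequality would kill exactly one term of [triangle_relation]. *)
  pose s (l : 'I_3) := (match val l with
    0 => minn (ug + uh + uk) (vg + vh + vk) | 1 => vg + (uh + uk) | _ => vh + (vg + uk) end)%N.
  have s0 : s ord0 = minn (ug + uh + uk) (vg + vh + vk) by [].
  have s1 : s (ordS ord0) = (vg + (uh + uk))%N by [].
  have s2 : s (ordS (ordS ord0)) = (vh + (vg + uk))%N by [].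
  have := he (g, ord0) (uh + uk)%N s.
  rewrite /= -/(u g _) -/(v g _) -/ug -/vg s0 s1.
  case=> [||r0 [gr0 r02 r00 r01 /(_ q1) [r00' _]]]; [lia | lia |].
  have := he (h, ordS ord0) (vg + uk)%N s.
  rewrite /= -/(u h _) -/(v h _) -/uh -/vh ordS3 s1 s2.
  case=> [||r1 [gr1 r12 r10 r11 _]]; [lia | lia |].
  have := he (k, ordS (ordS ord0)) (vg + vh)%N s.
  rewrite /= -/(u k _) -/(v k _) -/uk -/vk !ordS3 s0 s2.
  case=> [||r2 [gr2 r22 r20 r21 /(_ q1) [_ r21']]]; [lia | lia |].
  have := triangle_relation hgk gr0 gr1 gr2 r02 r12 r22.
  have {}r01 : r0 (ordS ord0) != 0 by apply: r01; lia.
  have {}r10 : r1 (ordS ord0) != 0 by apply: r10; lia.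
  have {}r11 : r1 (ordS (ordS ord0)) != 0 by apply: r11; lia.
  have {}r20 : r2 (ordS (ordS ord0)) != 0 by apply: r20; lia.
  have [lt|lt|//] := ltngtP (ug + uh + uk) (vg + vh + vk).
    have {}r00 : r0 ord0 != 0 by apply: r00; lia.
    have {}r21' : r2 ord0 = 0 by apply: r21'; lia.
    rewrite r21' mulr0 addr0 => /eqP.
    by rewrite !mulf_eq0 (negPf r00) (negPf r10) (negPf r20).
  have {}r00' : r0 ord0 = 0 by apply: r00'; lia.
  have {}r21 : r2 ord0 != 0 by apply: r21; lia.
  rewrite r00' !mul0r add0r => /eqP.
  by rewrite !mulf_eq0 (negPf r01) (negPf r11) (negPf r21).
(* The terms in [a] cancel around a triangle, so [uv_triangle] becomes the additive hypothesis. *)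
pose d i g : int := (u g i)%:Z + (a (ordS i))%:Z - (v g i)%:Z - (a i)%:Z.
have uv g i : (1 < q)%N -> (u g i + a (ordS i) = v g i + a i)%N.
  move=> q1.
  have d0 : d i g = 0.
    apply: Q8_additive_trivial => [g0 h k hgk|j].
      by have := uv_triangle _ _ _ q1 hgk; rewrite /d ordS3; lia.
    by have := uv_minus1 j q1; rewrite /d; lia.
  by move: d0; rewrite /d; lia.
(* Large enough for every Frobenius shift [a i + N0 - u g i] to be an exact subtraction. *)
pose N0 := \sum_(gi : Q8 * 'I_3) u gi.1 gi.2.
have leN0 g i : (u g i <= N0)%N.
  by rewrite /N0 (bigD1 (g, i)) //= leq_addr.
pose s l := (a l + N0)%N.
have ex_r (gi : Q8 * 'I_3) : exists wr : nat * ('I_3 -> L),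
    [/\ gradient iota (points s) (f (El gi.1 gi.2) ^+ (q ^ wr.1)) wr.2,
        wr.2 (ordS (ordS gi.2)) = 0, wr.2 gi.2 != 0 & wr.2 (ordS gi.2) != 0].
  case: gi => g i /=; have [leq1|q1] := leqP q 1.
    have q1 : q = 1%N by apply/eqP; rewrite eqn_leq leq1 (expchar_gt0 Kq).
    pose s' l := if l == i then u g i else v g i.
    have neS : (ordS i == i) = false by case: (i) => [[|[|[|j]]] Hj].
    have := he (g, i) 0%N s'; rewrite /= /s' neS eqxx !addn0 -/(u g i) -/(v g i).
    case=> // r [gr r2 r0 r1 _]; exists ((e (g, i)).1.1, r).
    split=> //=; [|exact: r0|exact: r1]; apply: eq_gradient gr => l.
    by rewrite /points q1 !exp1n.
  have uvgi := uv g i q1; have leu := leN0 g i.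
  have := he (g, i) (a i + N0 - u g i)%N s; rewrite /= -/(u g i) -/(v g i) /s.
  case=> [||r [gr r2 r0 r1 _]]; [lia | lia |].
  exists ((e (g, i)).1.1 + (a i + N0 - u g i), r)%N.
  by split=> //=; [apply: r0 | apply: r1]; lia.
have [wr hwr] := fin_all_exists ex_r.
pose r g i : 'I_3 -> L := (wr (g, i)).2; pose o' l := o l ^+ (q ^ N0).
(* The factors in [o'] cancel around a triangle, where the three ratios of coefficients multiply to
   -1; the three signs turn this into 1. At [minus1], proportionality to [o'] leaves just the
   sign. *)
pose X i g := - (r g i (ordS i) / r g i i) * (o' i / o' (ordS i)).
have r0 g i : r g i i != 0 by case: (hwr (g, i)).
have r1 g i : r g i (ordS i) != 0 by case: (hwr (g, i)).
have r2 g i : r g i (ordS (ordS i)) = 0 by case: (hwr (g, i)).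
have o'0 l : o' l != 0 by apply: oN.
apply: (@Q8_multiplicative_char2 L X) => [g h k hgk|i].
  have [g0 _ _ _] := hwr (g, ord0).
  have [g1 _ _ _] := hwr (h, ordS ord0).
  have [g2 _ _ _] := hwr (k, ordS (ordS ord0)).
  have := r2 h (ordS ord0); have := r2 k (ordS (ordS ord0)).
  rewrite !ordS3 => r2k r2h.
  have := triangle_relation hgk g0 g1 g2 (r2 _ _) r2h r2k.
  rewrite /X ordS3 /=; rewrite -/(r g _) -/(r h _) -/(r k _).
  have := r1 k (ordS (ordS ord0)); rewrite ordS3.
  move: (r0 g ord0) (r1 g ord0) (r0 h (ordS ord0)) (r1 h (ordS ord0)) (r0 k (ordS (ordS ord0))).
  move: (o'0 ord0) (o'0 (ordS ord0)) (o'0 (ordS (ordS ord0))).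
  move=> n1 n2 n3 n4 n5 n6 n7 n8 n9 /eqP; rewrite addr_eq0 => /eqP E.
  transitivity (- (r g ord0 (ordS ord0) * r h (ordS ord0) (ordS (ordS ord0)) *
      r k (ordS (ordS ord0)) ord0) / (r g ord0 ord0 * r h (ordS ord0) (ordS ord0) *
      r k (ordS (ordS ord0)) (ordS (ordS ord0)))).
    by field; rewrite n1 n2 n3 n4 n6 n8.
  by rewrite -E divff // !mulf_neq0.
have [g0 _ _ _] := hwr (minus1, i).
have := minus1_proportional (grad_oN N0) g0 (r2 _ _).
rewrite -/(r _ _) -/(o' _) -/(o' _) /X => E.
transitivity (- ((o' i * r minus1 i (ordS i)) / (o' (ordS i) * r minus1 i i))).
  by field; rewrite r0 o'0.
by rewrite E divff // mulf_neq0.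
Qed.

End Main.

Theorem theorem4p2 (F49 : finFieldType) (card_F49 : #|F49| = 49%N)
    (zeta4 : F49) (zeta4_prim : 4.-primitive_root zeta4) (K : fieldType) :
  algebraically_representable (QNF3_Q8 card_F49 zeta4_prim) K ->
  2%N \in [pchar K].
Proof.
move=> [L [iota [f rep]]]; have [q [Kq frob]] := expchar_exists K.
have [fK [fL [fKE fLE]]] := frob L iota.
by rewrite -(fmorph_pchar iota); apply: (representation_char2 fKE fLE Kq rep).
Qed.
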